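(* Let $P(x)$ be an $m \times m$ polynomial matrix in $x\in\mathbb{R}^n$ that is positive semidefinite for all $x\in\mathbb{R}^n$ and whose sparsity graph is chordal with maximal cliques $\mathcal{C}_1,\ldots,\mathcal{C}_t$. Then there exist an SOS polynomial $\sigma(x)$, not identically zero, and SOS matrices $S_k(x)$ of size $|\mathcal{C}_k| \times |\mathcal{C}_k|$, $k=1,\ldots,t$, such that $$\sigma(x) P(x)= \sum_{k=1}^{t} E_{\mathcal{C}_k}^{\mathsf T} S_k(x) E_{\mathcal{C}_k}.$$
   Context: Polynomials have real coefficients and variables $x=(x_1,\ldots,x_n)$. An $m\times m$ polynomial matrix $P$ is a symmetric matrix with polynomial entries. Its sparsity graph is the undirected graph with vertices $\{1,\ldots,m\}$ and edge set $\mathcal{E}$ such that, for $i\ne j$, $(i,j)\notin\mathcal{E}$ if and only if $P_{ij}\equiv 0$. A clique is a set of vertices that are pairwise connected by edges; it is maximal if not contained in any other clique. A graph is chordal if every cycle of length at least $4$ has a chord (an edge joining two nonconsecutive vertices of the cycle). For a clique $\mathcal{C}$, with elements listed as $\mathcal{C}(1),\ldots,\mathcal{C}(|\mathcal{C}|)$ in increasing order, $E_{\mathcal{C}}\in\mathbb{R}^{|\mathcal{C}|\times m}$ is the matrix with $(E_{\mathcal{C}})_{ij}=1$ if $\mathcal{C}(i)=j$ and $0$ otherwise. A polynomial matrix $S(x)$ is SOS if $S(x)=H(x)^{\mathsf T}H(x)$ for some (possibly rectangular) polynomial matrix $H(x)$; an SOS polynomial is a finite sum of squares of polynomials. *)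

(* Defs.v *)
From mathcomp Require Import all_boot all_order all_algebra.
From mathcomp Require Import reals.
From mathcomp Require Import mpoly.

Set Implicit Arguments.
Unset Strict Implicit.
Unset Printing Implicit Defensive.

Import Order.TTheory GRing.Theory Num.Theory.

Local Open Scope ring_scope.

Section Graphs.
Variables (T : finType) (e : rel T).

Definition clique (A : {set T}) : bool :=
  [forall i in A, forall j in A, (i != j) ==> e i j].

Definition maximal_clique (A : {set T}) : bool := maxset clique A.

(* [ucycle e c] says that the distinct vertices listed in [c] form a cycle of
   [e] closing up from the last vertex to the first; [next c x] is the cyclic
   successor of [x] in [c]. *)
Definition chordal : Prop :=
  forall c : seq T, (4 <= size c)%N -> ucycle e c ->
  exists x y : T,
    [/\ x \in c, y \in c, x != y, y != next c x /\ x != next c y & e x y].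

End Graphs.

Definition sparsity_graph (S : nmodType) (m : nat) (P : 'M[S]_m) : rel 'I_m :=
  fun i j => (i != j) && (P i j != 0).

(* [enum_val] lists the elements of [C] in increasing order. *)
Definition clique_mx (S : pzSemiRingType) (m : nat) (C : {set 'I_m}) :
    'M[S]_(#|C|, m) :=
  \matrix_(i, j) (enum_val i == j)%:R.

Definition psd (R : realType) (m : nat) (A : 'M[R]_m) : Prop :=
  A^T = A /\ forall v : 'cV[R]_m, 0 <= (v^T *m A *m v) ord0 ord0.

Definition sos_poly (n : nat) (R : realType) (p : {mpoly R[n]}) : Prop :=
  exists s : seq {mpoly R[n]}, p = \sum_(q <- s) q ^+ 2.

Definition sos_mx (n : nat) (R : realType) (m : nat)
    (S : 'M[{mpoly R[n]}]_m) : Prop :=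
  exists (r : nat) (H : 'M[{mpoly R[n]}]_(r, m)), S = H^T *m H.

(* Main.v *)
(* Cholesky elimination along a perfect elimination order reduces the matrix
   statement to Hilbert's 17th problem.  If [i] is a simplicial vertex of the
   graph and [w] is the [i]-th row of [P], then [P_ii P = w^T w + P'] where
   [w] is supported on a clique and [P' = P_ii P - w^T w] is again positive
   semidefinite (Cauchy-Schwarz), vanishes on row and column [i], and has no
   nonzero entry outside the graph.  Artin's theorem turns the nonnegative
   polynomial [P_ii] into a sum of squares after multiplication by a nonzero
   sum of squares.

   For Artin's theorem, embed [R[x]] in an algebraically closed field, here an
   ultrapower of the complex numbers.  If [f] has no representation, then the
   elements [s - f t] with [s], [t] sums of squares form a proper cone, and a
   maximal cone containing them is the set of nonnegative elements of a real
   closed field [K] (Artin-Schreier), in which [f] is negative.  Tarski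
   queries, one variable at a time, transfer a point where [f < 0] from [K] to
   [R]: the signs of finitely many coefficients determine whether such a point
   exists. *)
Require Import Defs.
From HB Require Import structures.
From mathcomp Require Import boolp classical_sets filter.
From mathcomp Require Import all_boot all_order all_algebra.
From mathcomp Require Import reals.
From mathcomp Require Import complex polyorder polyrcf qe_rcf_th.
From mathcomp Require Import generic_quotient zify ring.
From mathcomp Require Import mpoly.

Set Implicit Arguments.
Unset Strict Implicit.
Unset Printing Implicit Defensive.

Import Order.TTheory GRing.Theory Num.Theory.

Local Open Scope ring_scope.

(** * Simplicial vertices of chordal graphs *)

Section Chordal.
Variables (T : finType) (e : rel T).
Hypotheses (e_sym : ssrbool.symmetric e) (e_irr : irreflexive e).
Hypothesis e_chordal : chordal e.

Definition simplicial (V : {set T}) (v : T) :=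
  {in V &, forall x y, e v x -> e v y -> x != y -> e x y}.

(** Splices out the vertices strictly between positions [i] and [j] of [s :: p]; there is at least
    one, since [i.+1 < j]. *)
Lemma path_shortcut (r : rel T) (s : T) (p : seq T) (i j : nat) :
  path r s p -> (i.+1 < j <= size p)%N -> r (nth s (s :: p) i) (nth s (s :: p) j) ->
  exists q, [/\ path r s q, last s q = last s p & (size q < size p)%N].
Proof.
move=> rp /andP[ij jp] rij; case: j => // k in ij jp rij *.
have pE : p = take k p ++ nth s p k :: drop k.+1 p.
  by rewrite -drop_nth // cat_take_drop.
exists (take i p ++ nth s p k :: drop k.+1 p); split.
- rewrite cat_path /=; move: (rp); rewrite {1}pE cat_path /= => /and3P[_ _ ->].
  rewrite andbT take_path //= (last_nth s) size_takel; last by lia.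
  have -> : s :: take i p = take i.+1 (s :: p) by [].
  by rewrite nth_take.
- by rewrite [in RHS]pE !last_cat.
- by rewrite size_cat /= size_takel ?size_drop; lia.
Qed.

(** A walk of minimal length inside [A] works: a repeated vertex or a chord would allow a shorter
    one. *)
Lemma chordless_path (A : {set T}) (s t : T) :
  connect [rel x y | [&& e x y, x \in A & y \in A]] s t -> s \in A ->
  exists p, [/\ path e s p, last s p = t, uniq (s :: p), {subset s :: p <= A} &
    forall i j, (i.+1 < j <= size p)%N -> ~~ e (nth s (s :: p) i) (nth s (s :: p) j)].
Proof.
set r := [rel x y | _] => /connectP[p0 rp0 tE] sA.
pose ex_path n := [exists q : n.-tuple T, path r s q && (last s q == t)].
have [|n /existsP[p /andP[rp /eqP pt]] nmin] := @ex_minnP ex_path.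
  by exists (size p0); apply/existsP; exists (in_tuple p0); rewrite /= rp0 -tE eqxx.
have short q : path r s q -> last s q = t -> (n <= size q)%N.
  move=> rq qt; apply: nmin; apply/existsP; exists (in_tuple q).
  by rewrite /= rq qt eqxx.
have rA q z : path r z q -> {subset q <= A}.
  elim: q z => //= y q IHq z /andP[/and3P[_ _ yA] /IHq h] x.
  by rewrite inE => /predU1P[->//|/h].
have spA : {subset s :: p <= A}.
  by move=> x; rewrite inE => /predU1P[->//|]; apply: rA rp _.
exists p; split=> //.
- by apply: sub_path rp => x y /and3P[].
- move: (pt); case/shortenP: (rp) => q rq uq sq qt.
  (* The loop-free shortening [q] uses only vertices of [p] and, by minimality, is no shorter, so
     [s :: p] has no repetition. *)
  apply: (leq_size_uniq uq); last by rewrite /= size_tuple ltnS short.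
  by move=> x; rewrite !inE => /predU1P[->|/sq ->]; rewrite ?eqxx ?orbT.
move=> i j ij; apply/negP => eij.
have [|q [rq qt]] := @path_shortcut r s p i j rp ij.
  by apply/and3P; split=> //; apply/spA/mem_nth; rewrite /=; move: ij; lia.
by rewrite size_tuple ltnNge short // qt.
Qed.

(* The cycle through [u] and a shortest path through [C] would be chordless. *)
Lemma separator_adjacent (C : {set T}) (u s t : T) :
  {in C, forall c, (c != u) && ~~ e u c} -> e u s -> e u t -> s != t ->
  connect [rel x y | [&& e x y, x \in s |: (t |: C) & y \in s |: (t |: C)]] s t ->
  e s t.
Proof.
move=> Cu us ut st con; apply: contraT => nst.
have [|p [ep pt up pA chordless]] := chordless_path con; first by rewrite !inE eqxx.
have p2 : (1 < size p)%N.
  case: p ep pt {up pA chordless} => [|x [|y p]] //= ep pt.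
    by rewrite pt eqxx in st.
  by case/andP: ep; rewrite pt (negPf nst).
have uNp : u \notin s :: p.
  apply/negP => /pA; rewrite !inE => /or3P[/eqP us'|/eqP ut'|/Cu].
  - by rewrite us' e_irr in us.
  - by rewrite ut' e_irr in ut.
  - by rewrite eqxx.
pose c := u :: s :: p.
have [] := e_chordal (c := c); first by rewrite /c /=; lia.
  apply/andP; split; last by rewrite /c cons_uniq uNp.
  by rewrite /c /= rcons_path us ep pt e_sym.
have nextE x : x \in s :: p -> next c x = nth u (s :: p) (index x (s :: p)).+1.
  move=> xp; rewrite next_nth inE xp orbT [index _ _]/=; case: eqP => // ux.
  by rewrite ux xp in uNp.
have nextu : next c u = s by rewrite next_nth mem_head /= eqxx.
have nextt : next c t = u.
  have tp : t \in s :: p by rewrite -pt mem_last.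
  have tE : t = nth s (s :: p) (size p) by rewrite -pt (last_nth s).
  by rewrite nextE // [in index _ _]tE index_uniq // nth_default.
(* A chord at [u] would have to end in [C], whose vertices are not adjacent to [u]: [s] and [t] are
   the cyclic neighbours of [u]. *)
have wlog_u y : y \in c -> u != y -> y != next c u -> u != next c y -> e u y -> False.
  rewrite inE => /predU1P[->|yp _]; first by rewrite eqxx.
  rewrite nextu => ys uy; have := pA y yp; rewrite !inE (negPf ys) /=.
  by case/predU1P => [yt|/Cu/andP[_ /negPf->]//]; rewrite yt nextt eqxx in uy.
have wlog_ij x y : x \in s :: p -> y \in s :: p -> y != next c x ->
    (index x (s :: p) < index y (s :: p))%N -> e x y -> False.
  move=> xp yp; rewrite nextE // => yx ij exy.
  have ix : (index x (s :: p)).+1 != index y (s :: p).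
    by apply: contra yx => /eqP ->; rewrite nth_index.
  have iy : (index y (s :: p) < size (s :: p))%N by rewrite index_mem.
  suff lt_ij : ((index x (s :: p)).+1 < index y (s :: p) <= size p)%N.
    by have := chordless _ _ lt_ij; rewrite !nth_index // exy.
  by move: (index x _) (index y _) iy ij ix => a b /=; lia.
move=> x [y [xc yc xy [yx xy'] exy]].
have [xu|xu] := eqVneq x u.
  by subst x; case: (wlog_u y).
have [yu|yu] := eqVneq y u.
  by subst y; case: (wlog_u x) => //; rewrite 1?eq_sym // e_sym.
have xp : x \in s :: p by move: xc; rewrite inE (negPf xu).
have yp : y \in s :: p by move: yc; rewrite inE (negPf yu).
have [ij|ji|ij] := ltngtP (index x (s :: p)) (index y (s :: p)).
- by case: (wlog_ij x y).
- by case: (wlog_ij y x) => //; rewrite e_sym.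
- by case/eqP: xy; rewrite -(nth_index s xp) ij nth_index.
Qed.
(** Dirac's argument, by induction on [#|V|]. The component [C] of [w] among the non-neighbours of
    [u] is bounded by a set [S] of neighbours of [u], which chordality makes a clique. A vertex of
    [C] that is simplicial in [S :|: C] is simplicial in [V]. Asking for a vertex away from a
    prescribed one is what lets the induction land in [C] rather than in [S]. *)
Lemma exists_simplicial_nonadjacent (V : {set T}) (u w : T) :
  u \in V -> w \in V -> w != u -> ~~ e u w ->
  exists v, [/\ v \in V, v != u, ~~ e u v & simplicial V v].
Proof.
have [n] := ubnP #|V|; elim: n => // n IHn in V u w *.
rewrite ltnS => leVn uV wV wu nuw.
pose W := [set x in V | (x != u) && ~~ e u x].
pose rW := [rel x y | [&& e x y, x \in W & y \in W]].
pose C := [set x | connect rW w x].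
have wC : w \in C by rewrite inE connect0.
have CW : {subset C <= W}.
  move=> x; rewrite inE => /connectP[p rp ->].
  have wW : w \in W by rewrite inE wV wu.
  elim: p (w) wW rp => //= y p IHp z _ /andP[/and3P[_ _ yW]]; exact: IHp.
pose S := [set s in V | (s \notin C) && [exists c in C, e s c]].
have CVu c : c \in C -> [/\ c \in V, c != u & ~~ e u c].
  by move/CW; rewrite inE => /and3P.
have Cu : {in C, forall c, (c != u) && ~~ e u c}.
  by move=> c /CVu[_ -> ->].
have Su s : s \in S -> e u s.
  rewrite inE => /and3P[sV sC /exists_inP[c cC esc]].
  have [su|su] := eqVneq s u.
    by move/CVu: cC => [_ _ /negP]; rewrite -su esc.
  apply: contraT => nus; case/negP: sC; rewrite inE.
  have sW : s \in W by rewrite inE sV su.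
  move: (cC); rewrite inE => wc; apply: connect_trans wc _.
  by apply: connect1; rewrite /= e_sym esc sW CW.
have S_clique : {in S &, forall s t, s != t -> e s t}.
  move=> s t sS tS st; apply: (separator_adjacent Cu (Su s sS) (Su t tS) st).
  (* Both [s] and [t] have a neighbour in the connected set [C], so a walk through [C] joins
     them. *)
  set r := [rel x y | _].
  have r_sym : connect_sym r.
    by apply: sym_connect_sym => x y; rewrite /= e_sym; congr (_ && _); rewrite andbC.
  have toC x : x \in S -> x \in s |: (t |: C) -> exists2 c, c \in C & connect r x c.
    rewrite inE => /and3P[_ _ /exists_inP[c cC exc]] xA; exists c => //.
    by apply: connect1; rewrite /= exc xA !in_setU cC !orbT.
  have inC c : c \in C -> connect r w c.
    rewrite inE => /connectP[p rp ->]; apply/connectP; exists p => //.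
    elim: p (w) wC rp => //= y p IHp z zC /andP[/andP[ezy zyW] rp].
    have yC : y \in C.
      move: zC; rewrite !inE => /connect_trans; apply.
      by apply: connect1; rewrite /= ezy.
    by rewrite ezy !in_setU zC yC !orbT /=; apply: IHp.
  have [|c cC sc] := toC s sS; first exact: setU11.
  have [|d dC td] := toC t tS; first by rewrite in_setU setU11 orbT.
  apply: connect_trans sc _; rewrite r_sym; apply: connect_trans td _.
  by rewrite r_sym; apply: connect_trans (inC d dC); rewrite r_sym; apply: inC.
pose V' := S :|: C.
have V'V : V' \subset V.
  by apply/subsetP => x; rewrite inE => /orP[|/CVu[]//]; rewrite inE => /andP[].
have ltV' : (#|V'| < n)%N.
  apply: leq_trans leVn; apply: proper_card; apply/properP; split=> //.
  exists u => //; rewrite inE negb_or; apply/andP; split.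
    by apply/negP => /Su; rewrite e_irr.
  by apply/negP => /CVu[_]; rewrite eqxx.
have lift v : v \in C -> simplicial V' v ->
    exists v, [/\ v \in V, v != u, ~~ e u v & simplicial V v].
  move=> vC sv; have [vV vu nuv] := CVu v vC; exists v; split=> //.
  have nb x : x \in V -> e v x -> x \in V'.
    move=> xV evx; rewrite in_setU orbC; have [//|xC /=] := boolP (x \in C).
    by rewrite in_set xV xC; apply/exists_inP; exists v; rewrite // e_sym.
  by move=> x y xV yV evx evy; apply: sv; rewrite ?nb.
have IH a b : a \in V' -> b \in V' -> b != a -> ~~ e a b ->
  exists v, [/\ v \in V', v != a, ~~ e a v & simplicial V' v] by apply: IHn.
(* If some [s] in [S] misses a vertex of [V'], induction gives a simplicial vertex not adjacent to
   [s], hence outside the clique [S]. *)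
have [/existsP[s /existsP[b /and4P[sS bV' bs nsb]]]|/existsPn noS] :=
  boolP [exists s, exists b, [&& s \in S, b \in V', b != s & ~~ e s b]].
  have [|v [vV' vs nsv sv]] := IH s b _ bV' bs nsb; first by rewrite in_setU sS.
  apply: (lift v) => //; move: vV'; rewrite in_setU => /orP[vS|//].
  by case/negP: nsv; apply: S_clique; rewrite // eq_sym.
have univ s b : s \in S -> b \in V' -> b != s -> e s b.
  move=> sS bV' bs; have /existsPn/(_ b) := noS s.
  by rewrite sS bV' bs /= negbK.
(* Now [S] is joined to all of [V'], so a vertex not adjacent to some [a] in [C] cannot lie in
   [S]. *)
have [/existsP[a /existsP[b /and4P[aC bC ba nab]]]|/existsPn noC] :=
  boolP [exists a, exists b, [&& a \in C, b \in C, b != a & ~~ e a b]].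
  have [||v [vV' va nav sv]] := IH a b _ _ ba nab; do ?by rewrite in_setU ?aC ?bC orbT.
  apply: (lift v) => //; move: vV'; rewrite in_setU => /orP[vS|//].
  case/negP: nav; rewrite e_sym; apply: univ => //; last by rewrite eq_sym.
  by rewrite in_setU aC orbT.
(* In the remaining case [V'] is a clique, and [w] itself is simplicial. *)
apply: (lift w) => // x y xV' yV' _ _ xy.
move: (xV'); rewrite in_setU => /orP[xS|xC]; first by apply: univ; rewrite // eq_sym.
move: (yV'); rewrite in_setU => /orP[yS|yC]; first by rewrite e_sym; apply: univ.
have /existsPn/(_ y) := noC x.
by rewrite xC yC eq_sym xy /= negbK.
Qed.

Lemma exists_simplicial (V : {set T}) : V != set0 ->
  exists2 v, v \in V & simplicial V v.
Proof.
case/set0Pn=> u uV.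
have [/existsP[a /existsP[b /and4P[aV bV ba nab]]]|/existsPn noV] :=
  boolP [exists a, exists b, [&& a \in V, b \in V, b != a & ~~ e a b]].
  have [v [vV _ _ sv]] := exists_simplicial_nonadjacent aV bV ba nab.
  by exists v.
exists u => // x y xV yV _ _ xy; have /existsPn/(_ y) := noV x.
by rewrite xV yV eq_sym xy /= negbK.
Qed.

End Chordal.

(** * Transfer between real closed fields *)

Lemma modp_scale_eq (F : fieldType) (c : F) (p q d r : {poly F}) :
  c *: p = d * q + r -> (size r < size q)%N -> r = c *: (p %% q).
Proof.
move=> e lt_r; rewrite -modpZl e modp_addl_mul_small //.
Qed.

Lemma cindexRZ (K : rcfType) (c : K) (p q : {poly K}) :
  cindexR (c *: p) q = sgz c * cindexR p q.
Proof. by rewrite /cindexR mulr_sumr; apply: eq_bigr => x _; rewrite jump_mulCp. Qed.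

Lemma next_mod_modp (K : rcfType) (p q : {poly K}) : q != 0 ->
  next_mod p q = - (lead_coef q ^+ (Pdiv.Ring.rscalp p q).*2) *: (p %% q).
Proof.
move=> q0; rewrite /next_mod.
rewrite (@modp_scale_eq _ (lead_coef q ^+ Pdiv.Ring.rscalp p q) p q
   (Pdiv.Ring.rdivp p q) (Pdiv.Ring.rmodp p q)).
- by rewrite scalerA mulNr -exprD addnn.
- by rewrite Pdiv.ComRing.rdivp_eq // mulrC.
- by rewrite Pdiv.Ring.ltn_rmodp.
Qed.

Lemma eq_variation (K L : rcfType) (x y : K) (x' y' : L) :
  sgz x = sgz x' -> sgz y = sgz y' -> variation x y = variation x' y'.
Proof.
by move=> ex ey; rewrite /variation -sgz_lt0 -[in RHS]sgz_lt0 !sgzM ex ey.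
Qed.

(* The product is [2 ^ size gs] when all of [gs] are positive at [x], and [0]
   otherwise; expanding it expresses the sum through Tarski queries. *)
Definition weighted_taq (K : rcfType) (z : seq K) (q : {poly K})
    (gs : seq {poly K}) : int :=
  \sum_(x <- z) sgz q.[x] * \prod_(g <- gs) (sgz g.[x] + sgz g.[x] ^+ 2).

Lemma weighted_taq_cons (K : rcfType) (z : seq K) (q g : {poly K}) gs :
  weighted_taq z q (g :: gs) =
  weighted_taq z (q * g) gs + weighted_taq z (q * g ^+ 2) gs.
Proof.
rewrite /weighted_taq -big_split; apply: eq_bigr => x _.
by rewrite big_cons !hornerM !sgzM /=; ring.
Qed.

Lemma mem_rootsR (K : rcfType) (p : {poly K}) x :
  p != 0 -> (x \in rootsR p) = root p x.
Proof. by move=> p0; have <- := roots_on_rootsR p0 x; rewrite in_itv. Qed.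

Lemma weighted_taq_gt0 (K : rcfType) (p : {poly K}) (gs : seq {poly K}) :
  p != 0 ->
  reflect (exists x, root p x /\ {in gs, forall g, 0 < g.[x]})
    (0 < weighted_taq (rootsR p) 1 gs).
Proof.
move=> p0; have F_ge0 x : 0 <= \prod_(g <- gs) (sgz g.[x] + sgz g.[x] ^+ 2).
  by apply: prodr_ge0 => g _; case: sgzP.
rewrite /weighted_taq; under eq_bigr do rewrite hornerC sgz1 mul1r.
rewrite lt0r sumr_ge0 ?andbT //; apply: (iffP idP).
  rewrite psumr_neq0 // => /hasP[x xp] /=; rewrite lt0r F_ge0 andbT => nz.
  exists x; split; first by rewrite -mem_rootsR.
  move=> g gs_g; rewrite ltNge; apply: contraNN nz; rewrite le_eqVlt => g0.
  rewrite prodf_seq_eq0; apply/hasP; exists g => //=.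
  by case/orP: g0; case: sgzP.
case=> x [px gx]; rewrite psumr_neq0 //; apply/hasP; exists x.
  by rewrite mem_rootsR.
rewrite /= lt0r F_ge0 andbT prodf_seq_neq0; apply/allP => g /gx g0 /=.
by rewrite gtr0_sgz.
Qed.

(** * Signed remainder sequences over an integral domain *)

Section SignTransfer.
Variable A : idomainType.

Definition same_signs (K L : rcfType) (s : seq A)
  (f : {rmorphism A -> K}) (g : {rmorphism A -> L}) :=
  {in s, forall c, sgz (f c) = sgz (g c)}.

(** The extra power of the leading coefficient makes the total scaling of [p] an even power: under a
    morphism to an ordered field that keeps [lead_coef q] nonzero, this is a positive multiple of
    the negated remainder, while the coefficients stay in [A]. *)
Definition sprem (p q : {poly A}) : {poly A} :=
  - (lead_coef q ^+ Pdiv.Idomain.scalp p q) *: (p %% q).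


Lemma sprem_map (K : rcfType) (f : {rmorphism A -> K}) (p q : {poly A}) :
  f (lead_coef q) != 0 ->
  exists2 c : K, 0 < c &
    map_poly f (sprem p q) = c *: next_mod (map_poly f p) (map_poly f q).
Proof.
move=> fq0; pose l := f (lead_coef q).
have q0 : q != 0 by apply: contraNneq fq0 => ->; rewrite lead_coef0 rmorph0.
have Q0 : map_poly f q != 0.
  by rewrite -lead_coef_eq0 lead_coef_map_eq.
pose j := Pdiv.Ring.rscalp (map_poly f p) (map_poly f q).
have l2 k : 0 < l ^+ k.*2 by rewrite -muln2 exprM exprn_even_gt0 // expf_neq0.
(* Pseudo-division over [A] and over [K] may scale by different powers of [l]; [c] is the quotient
   of their squares. *)
exists (l ^+ (Pdiv.Idomain.scalp p q).*2 / l ^+ j.*2).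
  by rewrite divr_gt0.
rewrite next_mod_modp // scalerA lead_coef_map_eq // -/l -/j mulrN mulfVK; last first.
  by rewrite gt_eqF.
rewrite /sprem map_polyZ rmorphN rmorphXn /= -/l.
rewrite (@modp_scale_eq _ (l ^+ Pdiv.Idomain.scalp p q) (map_poly f p) (map_poly f q)
   (map_poly f (p %/ q)) (map_poly f (p %% q))).
- by rewrite scalerA mulNr -exprD addnn.
- by rewrite -rmorphXn -map_polyZ Pdiv.Idomain.divp_eq rmorphD rmorphM.
- rewrite (size_map_poly_id0 fq0); apply: leq_ltn_trans (size_poly _ _) _.
  by rewrite ltn_modp.
Qed.

Lemma cindexR_next_mod (K : rcfType) (f : {rmorphism A -> K}) (p q : {poly A}) :
  f (lead_coef q) != 0 ->
  cindexR (next_mod (map_poly f p) (map_poly f q)) (map_poly f q) =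
  cindexR (map_poly f (sprem p q)) (map_poly f q).
Proof.
move=> fq; have [c c0 ->] := @sprem_map _ _ p _ fq.
by rewrite [RHS]cindexRZ gtr0_sgz // mul1r.
Qed.

(** The signs at both infinities depend only on the degree and on the sign of the leading
    coefficient. *)
Lemma crossR_map (K L : rcfType) (f : {rmorphism A -> K})
    (g : {rmorphism A -> L}) (p : {poly A}) :
  f (lead_coef p) != 0 -> sgz (f (lead_coef p)) = sgz (g (lead_coef p)) ->
  crossR (map_poly f p) = crossR (map_poly g p).
Proof.
move=> fp e; have gp : g (lead_coef p) != 0 by rewrite -sgz_eq0 -e sgz_eq0.
rewrite /crossR; apply: eq_variation; rewrite /sgp_minfty /sgp_pinfty !sgz_sgr.
  rewrite !lead_coef_map_eq // !size_map_poly_id0 // !sgzM !sgzX !sgzN !sgz1.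
  by rewrite e.
by rewrite !lead_coef_map_eq.
Qed.

(** The signed remainder sequence is computed once over [A], and [s] collects the leading
    coefficients that fix the crossing numbers. Injectivity of [f] keeps them nonzero in [K], and
    agreement of signs does the same in [L]. *)
Lemma cindexR_transfer (p q : {poly A}) : exists s : seq A,
  forall (K L : rcfType) (f : {rmorphism A -> K}) (g : {rmorphism A -> L}),
  injective f -> same_signs s f g ->
  cindexR (map_poly f q) (map_poly f p) = cindexR (map_poly g q) (map_poly g p).
Proof.
have [n] := ubnP (size q); elim: n p q => // n IHn p q; rewrite ltnS => le_q.
have [->|p0] := eqVneq p 0.
  by exists [::] => K L f g _ _; rewrite !rmorph0 -!polyC0 !cindexRpC.
have [->|q0] := eqVneq q 0.
  by exists [::] => K L f g _ _; rewrite !rmorph0 !cindexR0p.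
have [|s hs] := IHn q (sprem p q).
  rewrite /sprem; apply: leq_trans le_q.
  by apply: leq_ltn_trans (size_scale_leq _ _) _; rewrite ltn_modp.
exists [:: lead_coef q, lead_coef (p * q) & s] => K L f g injf sfg.
have f0 (r : {poly A}) : r != 0 -> f (lead_coef r) != 0.
  by move=> r0; rewrite -(rmorph0 f) (inj_eq injf) lead_coef_eq0.
have eq := sfg _ (mem_head _ _).
have gq : g (lead_coef q) != 0 by rewrite -sgz_eq0 -eq sgz_eq0 f0.
rewrite (cindexR_rec (map_poly f p)) (cindexR_rec (map_poly g p)) -!rmorphM.
congr (_ + _).
  by apply: crossR_map; rewrite ?f0 ?mulf_neq0 // sfg // !inE eqxx orbT.
rewrite !cindexR_next_mod ?f0 //; apply: hs => // c cs.
by apply: sfg; rewrite !inE cs !orbT.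
Qed.

(** With [gs] empty this is a Tarski query, which equals a Cauchy index; each further member of [gs]
    splits the sum into two queries. *)
Lemma weighted_taq_transfer (p q : {poly A}) (gs : seq {poly A}) :
  exists s : seq A,
  forall (K L : rcfType) (f : {rmorphism A -> K}) (g : {rmorphism A -> L}),
  injective f -> same_signs s f g ->
  weighted_taq (rootsR (map_poly f p)) (map_poly f q) (map (map_poly f) gs) =
  weighted_taq (rootsR (map_poly g p)) (map_poly g q) (map (map_poly g) gs).
Proof.
elim: gs q => [|h gs IHgs] q.
  have [s hs] := cindexR_transfer p (p^`() * q); exists s => K L f g injf sfg.
  have taqE (M : rcfType) (e : {rmorphism A -> M}) :
      weighted_taq (rootsR (map_poly e p)) (map_poly e q) [::] =
      cindexR (map_poly e (p^`() * q)) (map_poly e p).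
    rewrite rmorphM /= -deriv_map -changes_mods_cindex -/(taqR _ _) -taq_taqR.
    by apply: eq_bigr => x _; rewrite big_nil mulr1.
  by rewrite !taqE; apply: hs.
have [s1 hs1] := IHgs (q * h); have [s2 hs2] := IHgs (q * h ^+ 2).
exists (s1 ++ s2) => K L f g injf sfg.
have sfg1 : same_signs s1 f g by move=> c cs; apply: sfg; rewrite mem_cat cs.
have sfg2 : same_signs s2 f g.
  by move=> c cs; apply: sfg; rewrite mem_cat cs orbT.
by rewrite !weighted_taq_cons -!rmorphXn -!rmorphM /= (hs1 _ _ f g) // (hs2 _ _ f g).
Qed.

(** By Rolle's theorem, if [gs] are simultaneously positive somewhere, they are so near an infinity
    or at a root of the derivative [D] of their product. Leading coefficients decide the first two
    cases, a weighted Tarski query over the roots of [D] the third. *)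
Lemma positive_point_transfer (gs : seq {poly A}) : exists s : seq A,
  forall (K L : rcfType) (f : {rmorphism A -> K}) (g : {rmorphism A -> L}),
  injective f -> same_signs s f g ->
  forall y, {in gs, forall h, 0 < (map_poly f h).[y]} ->
  exists z, {in gs, forall h, 0 < (map_poly g h).[z]}.
Proof.
pose D := (\prod_(h <- gs) h)^`().
have [s hs] := weighted_taq_transfer D 1 gs.
exists (lead_coef D :: map lead_coef gs ++ s) => K L f g injf sfg y hy.
have boundE (M : rcfType) (e : {rmorphism A -> M}) :
    bounding_poly (map (map_poly e) gs) = map_poly e D.
  by rewrite /bounding_poly big_map -rmorph_prod deriv_map.
have f0 (r : {poly A}) : r != 0 -> f (lead_coef r) != 0.
  by move=> r0; rewrite -(rmorph0 f) (inj_eq injf) lead_coef_eq0.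
have lc0 h : h \in gs -> sgz (f (lead_coef h)) = sgz (g (lead_coef h)).
  by move=> hgs; apply: sfg; rewrite inE mem_cat map_f // orbT.
have gs0 h : h \in gs -> h != 0.
  by move/hy; apply: contraTneq => ->; rewrite rmorph0 horner0 ltxx.
have lcf h : h \in gs -> lead_coef (map_poly f h) = f (lead_coef h).
  by move=> hgs; rewrite lead_coef_map_eq // f0 ?gs0.
have g0 h : h \in gs -> g (lead_coef h) != 0.
  by move=> hgs; rewrite -sgz_eq0 -lc0 // sgz_eq0 f0 // gs0.
have lcg h : h \in gs -> lead_coef (map_poly g h) = g (lead_coef h).
  by move=> hgs; rewrite lead_coef_map_eq // g0.
have conv : [\/ {in gs, forall h, 0 < lead_coef (map_poly g h)},
   {in gs, forall h, 0 < (-1) ^+ (size (map_poly g h)).-1 * lead_coef (map_poly g h)} |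
   exists z, root (map_poly g D) z /\ {in gs, forall h, 0 < (map_poly g h).[z]}].
  have pos1 : {in gs, forall h, 0 < lead_coef (map_poly f h)} ->
      {in gs, forall h, 0 < lead_coef (map_poly g h)}.
    move=> H h hgs; have := H h hgs.
    by rewrite lcf // lcg // -sgz_gt0 lc0 // sgz_gt0.
  (* If [D = 0], all of [gs] become constants, with the signs of their leading coefficients. *)
  have [D0|D0] := eqVneq D 0.
    constructor 1; apply: pos1 => h hgs.
    have : size (\prod_(h <- map (map_poly f) gs) h) == 1%N.
      rewrite eqn_leq size_poly_gt0 prodf_seq_neq0 big_map -rmorph_prod.
      rewrite derivn_poly0 derivn1 deriv_map -/D D0 rmorph0 eqxx /=.
      apply/allP => _ /mapP[k kgs ->] /=.
      by rewrite -lead_coef_eq0 lcf ?f0 ?gs0.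
    move/size_prod_eq1 => /(_ _ (map_f _ hgs)) s1.
    have := hy h hgs.
    by rewrite [map_poly f h]size1_polyC ?s1 // hornerC lead_coefC.
  have : exists y, \big[andb/true]_(q <- map (map_poly f) gs) (0 < q.[y]).
    by exists y; rewrite big_all all_map; apply/allP => h /hy.
  move/bounding_polyP; rewrite !big_all !all_map boundE => -[/allP H|/allP H|[x]].
  - by constructor 1; apply: pos1 => h /H.
  - constructor 2 => h hgs; have /= := H h hgs.
    rewrite lcf // lcg // !size_map_poly_id0 ?f0 ?g0 ?gs0 //.
    by rewrite -sgz_gt0 -[in X in _ -> X]sgz_gt0 !sgzM !sgzX !sgzN !sgz1 lc0.
  rewrite big_all all_map => /andP[Dx /allP Hx]; constructor 3.
  have gD : g (lead_coef D) != 0.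
    by rewrite -sgz_eq0 -sfg ?mem_head // sgz_eq0 f0.
  have fD0 : map_poly f D != 0 by rewrite -lead_coef_eq0 lead_coef_map_eq ?f0.
  have gD0 : map_poly g D != 0 by rewrite -lead_coef_eq0 lead_coef_map_eq ?f0.
  have : 0 < weighted_taq (rootsR (map_poly f D)) 1 (map (map_poly f) gs).
    apply/weighted_taq_gt0 => //; exists x; split=> // _ /mapP[h hgs ->].
    exact: Hx.
  have := hs _ _ _ _ injf (_ : same_signs s f g); rewrite !rmorph1 => ->; last first.
    by move=> c cs; apply: sfg; rewrite inE mem_cat cs !orbT.
  move/weighted_taq_gt0 => /(_ gD0)[z [Dz Hz]]; exists z; split=> // h hgs.
  exact/Hz/map_f.
suff [z Hz] : exists z, \big[andb/true]_(q <- map (map_poly g) gs) (0 < q.[z]).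
  by exists z => h hgs; move: Hz; rewrite big_all all_map => /allP; apply.
apply/bounding_polyP; rewrite !big_all !all_map boundE.
case: conv => [H|H|[z [Dz Hz]]].
- by constructor 1; apply/allP.
- by constructor 2; apply/allP.
constructor 3; exists z; rewrite -rootE Dz big_all all_map; exact/allP.
Qed.

End SignTransfer.

(** * Multivariate polynomials, one variable at a time *)

Lemma muniK n (R : comNzRingType) (p : {mpoly R[n.+1]}) :
  (map_poly (@mwiden n R) (muni p)).['X_ord_max] = p.
Proof.
rewrite muniE rmorph_sum /= horner_sum [RHS]mpolyE; apply: eq_bigr => m _.
rewrite !map_polyZ map_polyXn /= !hornerZ hornerXn mwidenZ mwidenX -scalerAl.
congr (_ *: _); rewrite [RHS]mpolyXE_id (mpolyXE_id _ (mnmwiden _)).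
rewrite [RHS]big_ord_recr big_ord_recr /= mnmwiden_ordmax expr0 mulr1.
by congr (_ * _); apply: eq_bigr => i _; rewrite mnmwiden_widen mnmE.
Qed.

Lemma rmorph_muni n (R B : comNzRingType) (f : {rmorphism {mpoly R[n.+1]} -> B})
    (p : {mpoly R[n.+1]}) :
  f p = (map_poly (f \o @mwiden n R) (muni p)).[f 'X_ord_max].
Proof. by rewrite -[in LHS](muniK p) -horner_map /= -map_poly_comp. Qed.

Definition rcons_point (R : Type) n (a : 'I_n -> R) (z : R) (i : 'I_n.+1) : R :=
  if unlift ord_max i is Some j then a j else z.

Lemma meval_rcons_point (R : comNzRingType) n (a : 'I_n -> R) (z : R)
    (p : {mpoly R[n.+1]}) :
  p.@[rcons_point a z] = (map_poly (meval a) (muni p)).[z].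
Proof.
rewrite (rmorph_muni (meval (rcons_point a z))) /= mevalXU.
rewrite [rcons_point a z _]/rcons_point unlift_none.
congr (_.[z]); apply: eq_map_poly => q /=.
pose f : {rmorphism {mpoly R[n]} -> R} := meval (rcons_point a z) \o @mwiden n R.
rewrite -[LHS]/(f q) [q]mpolyE !rmorph_sum; apply: eq_bigr => m _ /=.
rewrite mwidenZ mwidenX !mevalZ !mevalX big_ord_recr /= mnmwiden_ordmax expr0.
rewrite mulr1; congr (_ * _); apply: eq_bigr => i _.
rewrite mnmwiden_widen; congr (_ ^+ _).
have -> : widen_ord (leqnSn n) i = lift ord_max i.
  by apply: val_inj; rewrite /= /bump leqNgt ltn_ord.
by rewrite /rcons_point liftK.
Qed.

Lemma mpoly0_const (R : comNzRingType) (p : {mpoly R[0]}) : exists c, p = c%:MP.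
Proof.
exists p@_0; apply/mpolyP => m; rewrite mcoeffC.
by rewrite (_ : m = 0%MM) ?eqxx ?mulr1 //; apply/mnmP; case.
Qed.

(** The images of the variables under [f] form a point over [K] where [gs] are positive. Finitely
    many coefficient signs decide whether a last coordinate exists; the induction hypothesis
    realises these signs at a point [a] over [R], and the last coordinate is then transferred. *)
Lemma mpoly_positive_point (R : rcfType) n (K : rcfType)
    (f : {rmorphism {mpoly R[n]} -> K}) (gs : seq {mpoly R[n]}) :
  injective f -> {in gs, forall g, 0 < f g} ->
  exists a : 'I_n -> R, {in gs, forall g, 0 < g.@[a]}.
Proof.
elim: n => [|n IHn] in f gs *.
  move=> injf f_gt0; exists (fun=> 0) => g /f_gt0.
  have [c ->] := mpoly0_const g.
  (* As [R] is real closed, a nonpositive constant is minus a square, so its image cannot be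
     positive. *)
  rewrite mevalC !ltNge; apply: contraNN => c_le0.
  rewrite -[c]opprK -[- c]sqr_sqrtr ?oppr_ge0 // mpolyCN rmorphN oppr_le0.
  by rewrite expr2 mpolyCM rmorphM -expr2 sqr_ge0.
move=> injf f_gt0; pose fw : {rmorphism {mpoly R[n]} -> K} := f \o @mwiden n R.
have injfw : injective fw by apply: inj_comp => //; exact: inj_mwiden.
have [s hs] := positive_point_transfer (map (@muni n R) gs).
(* Each nonzero coefficient is taken with the sign that makes it positive in [K]. *)
have [|a ha] := IHn fw [seq (if 0 < fw c then c else - c) | c <- s & c != 0] injfw.
  move=> _ /mapP[c /[!mem_filter]/andP[c0 _] ->]; case: ifPn => //.
  move=> fc; rewrite rmorphN oppr_gt0 lt_neqAle leNgt fc andbT.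
  by rewrite -(rmorph0 fw) (inj_eq injfw).
have sfa : same_signs s fw (meval a).
  move=> c cs; have [->|c0] := eqVneq c 0; first by rewrite !rmorph0 !sgz0.
  have := ha (if 0 < fw c then c else - c).
  rewrite map_f ?mem_filter ?c0 // => /(_ isT).
  have [fc|fc|fc] := ltrgtP 0 (fw c).
  - by move=> ga; rewrite !gtr0_sgz.
  - by rewrite mevalN oppr_gt0 => ga; rewrite !ltr0_sgz.
  - by case/eqP: c0; apply: injfw; rewrite -fc rmorph0.
have [|z hz] := hs _ _ fw (meval a) injfw sfa (f 'X_ord_max).
  by move=> _ /mapP[g /f_gt0 fg ->]; rewrite -rmorph_muni.
exists (rcons_point a z) => g /(map_f (@muni n R))/hz.
by rewrite meval_rcons_point.
Qed.

Lemma mpoly_neq0_point (R : rcfType) n (p : {mpoly R[n]}) :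
  p != 0 -> exists a : 'I_n -> R, p.@[a] != 0.
Proof.
elim: n => [|n IHn] in p *.
  by have [c ->] := mpoly0_const p; rewrite mpolyC_eq0; exists (fun=> 0); rewrite mevalC.
move=> p0; have q0 : muni p != 0.
  by apply: contraNneq p0 => q0; rewrite -(muniK p) q0 rmorph0 horner0.
have [a ha] : exists a, (lead_coef (muni p)).@[a] != 0.
  by apply: IHn; rewrite lead_coef_eq0.
(* The last coordinate is a Cauchy bound of the specialised polynomial, which is nonzero by the
   choice of [a]. *)
exists (rcons_point a (cauchy_bound (map_poly (meval a) (muni p)))).
rewrite meval_rcons_point -rootE ge_cauchy_bound ?in_itv /= ?lexx //.
by rewrite -lead_coef_eq0 lead_coef_map_eq.

Qed.

(** * An algebraically closed extension of the polynomial ring *)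

Section Ultrapower.
Local Open Scope quotient_scope.
Variables (I : Type) (F : fieldType) (U : {U : set_system I | UltraFilter U}).

Let UF : ProperFilter (sval U).
Proof. exact: (@ultra_proper _ _ (svalP U)). Qed.

Local Existing Instance UF.

Definition ae_eq (f g : I -> F) : bool := `[< sval U [set i | f i = g i]%classic >].

Lemma ae_eq_refl : reflexive ae_eq.
Proof. by move=> f; apply/asboolP; apply: filterE. Qed.

Lemma ae_eq_sym : ssrbool.symmetric ae_eq.
Proof.
by move=> f g; apply/asboolP/asboolP; apply: filterS => i /= ->.
Qed.

Lemma ae_eq_trans : transitive ae_eq.
Proof.
move=> g f h /asboolP fg /asboolP gh; apply/asboolP.
by apply: filterS2 fg gh => i /= -> ->.
Qed.

Definition ae_equiv := EquivRel ae_eq ae_eq_refl ae_eq_sym ae_eq_trans.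

Definition ultrapower : Type := {eq_quot ae_equiv}.
HB.instance Definition _ := Choice.on ultrapower.

Definition ucls (f : I -> F) : ultrapower := \pi_{eq_quot ae_equiv} f.
Definition urep (x : ultrapower) : I -> F := repr (x : {eq_quot ae_equiv}).

Lemma urepK x : ucls (urep x) = x.
Proof. exact: reprK. Qed.

Lemma ucls_eqP f g : ucls f = ucls g <-> sval U [set i | f i = g i]%classic.
Proof.
split=> [/eqmodP/asboolP //|h]; apply/eqmodP; exact/asboolP.
Qed.

Lemma ucls_rep f : sval U [set i | urep (ucls f) i = f i]%classic.
Proof. by apply/ucls_eqP; rewrite urepK. Qed.

Definition uadd x y := ucls (fun i => urep x i + urep y i).
Definition umul x y := ucls (fun i => urep x i * urep y i).
Definition uopp x := ucls (fun i => - urep x i).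
Definition uinv x := ucls (fun i => (urep x i)^-1).

Lemma uaddE f g : uadd (ucls f) (ucls g) = ucls (fun i => f i + g i).
Proof.
by apply/ucls_eqP; apply: filterS2 (ucls_rep f) (ucls_rep g) => i /= -> ->.
Qed.

Lemma umulE f g : umul (ucls f) (ucls g) = ucls (fun i => f i * g i).
Proof.
by apply/ucls_eqP; apply: filterS2 (ucls_rep f) (ucls_rep g) => i /= -> ->.
Qed.

Lemma uoppE f : uopp (ucls f) = ucls (fun i => - f i).
Proof. by apply/ucls_eqP; apply: filterS (ucls_rep f) => i /= ->. Qed.

Lemma uinvE f : uinv (ucls f) = ucls (fun i => (f i)^-1).
Proof. by apply/ucls_eqP; apply: filterS (ucls_rep f) => i /= ->. Qed.

Lemma uP (P : ultrapower -> Prop) : (forall f, P (ucls f)) -> forall x, P x.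
Proof. by move=> h x; rewrite -(urepK x). Qed.

Let addA : associative uadd.
Proof.
elim/uP=> f; elim/uP=> g; elim/uP=> h; rewrite !uaddE; congr ucls.
by apply/funext => i; rewrite addrA.
Qed.

Let addC : commutative uadd.
Proof.
elim/uP=> f; elim/uP=> g; rewrite !uaddE; congr ucls.
by apply/funext => i; rewrite addrC.
Qed.

Let add0 : left_id (ucls (fun=> 0)) uadd.
Proof.
elim/uP=> f; rewrite !uaddE; congr ucls.
by apply/funext => i; rewrite add0r.
Qed.

Let addN : left_inverse (ucls (fun=> 0)) uopp uadd.
Proof.
elim/uP=> f; rewrite uoppE !uaddE; congr ucls.
by apply/funext => i; rewrite addNr.
Qed.

HB.instance Definition _ :=
  GRing.isZmodule.Build ultrapower addA addC add0 addN.

Let mulA : associative umul.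
Proof.
elim/uP=> f; elim/uP=> g; elim/uP=> h; rewrite !umulE; congr ucls.
by apply/funext => i; rewrite mulrA.
Qed.

Let mulC : commutative umul.
Proof.
elim/uP=> f; elim/uP=> g; rewrite !umulE; congr ucls.
by apply/funext => i; rewrite mulrC.
Qed.

Let mul1 : left_id (ucls (fun=> 1)) umul.
Proof.
elim/uP=> f; rewrite !umulE; congr ucls.
by apply/funext => i; rewrite mul1r.
Qed.

Let mulDl : left_distributive umul uadd.
Proof.
elim/uP=> f; elim/uP=> g; elim/uP=> h; rewrite ?(umulE, uaddE); congr ucls.
by apply/funext => i; rewrite mulrDl.
Qed.

Let one_neq0 : ucls (fun=> 1) != ucls (fun=> 0).
Proof.
apply/eqP => /ucls_eqP/filter_ex[i /= /eqP]; by rewrite oner_eq0.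
Qed.

HB.instance Definition _ :=
  GRing.Zmodule_isComNzRing.Build ultrapower mulA mulC mul1 mulDl one_neq0.

Let mulV (x : ultrapower) : x != 0 -> uinv x * x = 1.
Proof.
elim/uP: x => f f0; rewrite uinvE [LHS]umulE; apply/ucls_eqP.
(* An ultrafilter contains either the zero set of [f] or its complement, where the pointwise inverse
   works. *)
have [h|h] := in_ultra_setVsetC [set i | f i = 0]%classic (svalP U).
  by case/eqP: f0; apply/ucls_eqP.
by apply: filterS h => i /= /eqP; apply: mulVf.
Qed.

Let inv0 : uinv (0 : ultrapower) = 0.
Proof. by rewrite [LHS]uinvE; congr ucls; apply/funext => i; rewrite invr0. Qed.

HB.instance Definition _ := GRing.ComNzRing_isField.Build ultrapower mulV inv0.

Lemma ucls_add f g : ucls (fun i => f i + g i) = ucls f + ucls g.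
Proof. by rewrite -uaddE. Qed.

Lemma ucls_opp f : ucls (fun i => - f i) = - ucls f.
Proof. by rewrite -uoppE. Qed.

Lemma ucls_mul f g : ucls (fun i => f i * g i) = ucls f * ucls g.
Proof. by rewrite -umulE. Qed.

(** Coefficients are represented by functions and a root is chosen in each coordinate. *)
Lemma ultrapower_closed : GRing.closed_field_axiom F ->
  GRing.closed_field_axiom ultrapower.
Proof.
move=> closedF n P n_gt0.
pose root_at (i : I) (z : F) := z ^+ n = \sum_(j < n) urep (P j) i * z ^+ j.
have /boolp.choice[x hx] : forall i, exists z, root_at i z.
  by move=> i; apply: (closedF n (fun j => urep (P j) i)).
have uclsX k : ucls x ^+ k = ucls (fun i => x i ^+ k).
  elim: k => [|k IHk]; first by [].
  rewrite exprS IHk -ucls_mul; congr ucls; apply/funext => i.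
  by rewrite exprS.
have sumE m : ucls (fun i => \sum_(j < m) urep (P j) i * x i ^+ j) =
    \sum_(j < m) P j * ucls x ^+ j.
  elim: m => [|m IHm].
    by rewrite big_ord0; congr ucls; apply/funext => i; rewrite big_ord0.
  rewrite big_ord_recr -IHm /= -[X in _ + X * _]urepK uclsX -ucls_mul -ucls_add.
  by congr ucls; apply/funext => i; rewrite big_ord_recr.
by exists (ucls x); rewrite uclsX -sumE; congr ucls; apply/funext => i; apply: hx.
Qed.

End Ultrapower.

(* The ultrafilter contains the non-vanishing locus of every nonzero
   polynomial, so that polynomials embed into the ultrapower as functions. *)
Lemma mpoly_closed_extension (R : rcfType) n :
  exists (Omega : fieldType) (f : {rmorphism {mpoly R[n]} -> Omega}),
    injective f /\ GRing.closed_field_axiom Omega.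
Proof.
pose I := 'I_n -> R.
pose nz : set_system I := [set S | exists2 p : {mpoly R[n]}, p != 0 &
   forall a, p.@[a] != 0 -> S a]%classic.
have nzF : ProperFilter nz.
  apply: Build_ProperFilter_ex => [S [p p0 hS]|].
    by have [a pa] := mpoly_neq0_point p0; exists a; apply: hS.
  split.
  - exists 1 => //; exact: oner_neq0.
  - move=> S T [p p0 hS] [q q0 hT]; exists (p * q); first by rewrite mulf_neq0.
    by move=> a; rewrite mevalM mulf_eq0 negb_or => /andP[/hS Sa /hT].
  - by move=> S T ST [p p0 hS]; exists p => // a /hS/ST.
have [V [UV nzV]] := ultraFilterLemma nzF.
pose U := exist _ V UV : {V : set_system I | UltraFilter V}.
pose Omega := ultrapower R[i] U.
pose f (p : {mpoly R[n]}) : Omega := ucls U (fun a => (p.@[a])%:C%C).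
have fB : zmod_morphism f.
  move=> p q; rewrite /f -ucls_opp -ucls_add; congr ucls.
  by apply/funext => a; rewrite mevalB rmorphB.
have fM : monoid_morphism f.
  split; first by congr ucls; apply/funext => a; rewrite meval1.
  move=> p q; rewrite /f -ucls_mul; congr ucls.
  by apply/funext => a; rewrite mevalM rmorphM.
pose fA := GRing.isZmodMorphism.Build _ _ f fB.
pose fAM := GRing.isMonoidMorphism.Build _ _ f fM.
pose fR : {rmorphism {mpoly R[n]} -> Omega} := HB.pack f fA fAM.
exists Omega, fR; split; last exact/ultrapower_closed/solve_monicpoly.
move=> p q /eqP; rewrite -subr_eq0 -rmorphB => /eqP fpq; apply/eqP.
rewrite -subr_eq0; apply/negPn/negP => pq0.
have : sval U [set a | (p - q).@[a] != 0]%classic by apply: nzV; exists (p - q).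
have /ucls_eqP h := fpq; have UP := @ultra_proper _ _ UV.
by move=> /(filterI h)/filter_ex[a [/= /complexI ->]]; rewrite eqxx.
Qed.

(** * Maximal cones and real closed fields *)

Section WeightedSquares.
Variable K : realFieldType.

(** Weights are kept apart from the squares because a nonnegative element of [K] need not be a
    square in [K]. *)
Definition wsqr (s : seq (K * {poly K})) : {poly K} :=
  \sum_(u <- s) u.1 *: u.2 ^+ 2.

Definition nneg_weights (s : seq (K * {poly K})) := all (fun u => 0 <= u.1) s.

Lemma wsqr_horner s x : (wsqr s).[x] = \sum_(u <- s) u.1 * u.2.[x] ^+ 2.
Proof.
by rewrite horner_sum; apply: eq_bigr => u _; rewrite hornerZ horner_exp.
Qed.

Lemma wsqr_horner_ge0 s x : nneg_weights s -> 0 <= (wsqr s).[x].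
Proof.
move=> /allP s_ge0; rewrite wsqr_horner big_seq; apply: sumr_ge0 => u us.
by rewrite mulr_ge0 ?sqr_ge0 ?s_ge0.
Qed.

Lemma wsqr_root s x : nneg_weights s -> root (wsqr s) x ->
  {in s, forall u, u.1 != 0 -> root u.2 x}.
Proof.
move=> /allP s_ge0; rewrite rootE wsqr_horner big_seq psumr_eq0; last first.
  by move=> u us; rewrite mulr_ge0 ?sqr_ge0 ?s_ge0.
move=> /allP s0 u us u0; have /implyP/(_ us) := s0 u us.
by rewrite mulf_eq0 (negPf u0) /= sqrf_eq0.
Qed.

Section Descent.
Variables (g : {poly K}) (a b : K).
Hypothesis le_ab : a <= b.
Hypothesis sgn_g : g.[a] * g.[b] < 0.
Hypothesis noroot_g : forall c, a <= c <= b -> ~~ root g c.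
Hypothesis smaller_root : forall h : {poly K}, (size h < size g)%N ->
  h.[a] * h.[b] < 0 -> exists2 c, a <= c <= b & root h c.

(* Artin-Schreier descent: a weighted sum of squares of polynomials of smaller
   degree that is divisible by [g] has a root in [[a, b]], which can be
   divided out of every term. *)
Lemma wsqr_dvdp N (s : seq (K * {poly K})) :
  (N < size g)%N -> nneg_weights s -> all (fun u : K * {poly K} => (size u.2 <= N)%N) s ->
  g %| wsqr s -> {in s, forall u, u.1 = 0 \/ u.2 = 0}.
Proof.
elim: N => [|N IHN] in s *.
  move=> _ _ /allP s0 _ u /s0; rewrite leqn0 size_poly_eq0 => /eqP ->.
  by right.
move=> ltN s_ge0 s_size g_dvd.
have [c cab rc] : exists2 c, a <= c <= b & root (wsqr s) c.
  have [ra|ra] := boolP (root (wsqr s) a); first by exists a; rewrite ?lexx.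
  have [rb|rb] := boolP (root (wsqr s) b).
    by exists b; rewrite ?le_ab ?lexx.
  have Ha : 0 < (wsqr s).[a] by rewrite lt0r wsqr_horner_ge0 // andbT.
  have Hb : 0 < (wsqr s).[b] by rewrite lt0r wsqr_horner_ge0 // andbT.
  have H0 : wsqr s != 0 by apply: contraNneq ra => ->; rewrite root0.
  have eH := divpK g_dvd; set q := wsqr s %/ g in eH.
  have q0 : q != 0 by apply: contraNneq H0 => q0; rewrite -eH q0 mul0r.
  have g0 : g != 0 by apply: contraNneq H0 => q0'; rewrite -eH q0' mulr0.
  (* [q * g] is positive at both ends and [g] changes sign, so [q] does too. The sum has degree at
     most [2 * N] and [g] has degree above [N], which makes [q] smaller than [g]. *)
  have [||c cab rc] := smaller_root (h := q); last first.
  - by exists c => //; rewrite -eH rootM rc.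
  - have := mulr_gt0 Ha Hb; rewrite -eH !hornerM mulrACA.
    by rewrite nmulr_lgt0.
  have sH : (size (wsqr s) <= N.+1 + N)%N.
    rewrite /wsqr; apply: leq_trans (size_sum _ _ _) _; apply/bigmax_leqP_seq.
    move=> u us _; apply: leq_trans (size_scale_leq _ _) _.
    apply: leq_trans (size_polyMleq _ _) _.
    by have := allP s_size u us; rewrite /=; lia.
  have := size_mul q0 g0; rewrite eH => eS.
  by rewrite eS in sH; move: (size q) (size g) sH ltN => x y; lia.
pose s' := [seq (u.1, u.2 %/ ('X - c%:P)) | u <- s & u.1 != 0].
have us' u : u \in s -> u.1 != 0 -> u.2 = (u.2 %/ ('X - c%:P)) * ('X - c%:P).
  move=> us u0; rewrite divpK // dvdp_XsubCl.
  exact: (wsqr_root s_ge0 rc us u0).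
have eH : wsqr s = wsqr s' * ('X - c%:P) ^+ 2.
  rewrite /wsqr big_map big_filter [LHS](bigID (fun u => u.1 == 0)) /=.
  rewrite big1 ?add0r; last by move=> u /eqP ->; rewrite scale0r.
  rewrite mulr_suml big_seq_cond [RHS]big_seq_cond; apply: eq_bigr => u.
  by move=> /andP[us u0]; rewrite -scalerAl -exprMn -us'.
have g_dvd' : g %| wsqr s'.
  have cop : coprimep g (('X - c%:P) ^+ 2).
    by apply: coprimep_expr; rewrite coprimep_XsubC noroot_g.
  by rewrite -(Gauss_dvdpl _ cop) -eH.
move=> u us; have [u0|u0] := eqVneq u.1 0; [by left|right].
have s'_ge0 : nneg_weights s'.
  by apply/allP => _ /mapP[v /[!mem_filter]/andP[_ /(allP s_ge0) v0] ->].
have s'_size : all (fun u : K * {poly K} => (size u.2 <= N)%N) s'.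
  apply/allP => _ /mapP[v /[!mem_filter]/andP[_ /(allP s_size) v0] ->] /=.
  by rewrite size_divp ?polyXsubC_eq0 // size_XsubC subn1; case: (size _) v0.
have us'in : (u.1, u.2 %/ ('X - c%:P)) \in s'.
  by apply/mapP; exists u; rewrite // mem_filter u0.
have [/= /eqP|/= q0] := IHN s' (ltnW ltN) s'_ge0 s'_size g_dvd' _ us'in.
  by rewrite (negPf u0).
by rewrite (us' u us u0) q0 mul0r.
Qed.

End Descent.

Lemma wsqr_cat (s t : seq (K * {poly K})) : wsqr (s ++ t) = wsqr s + wsqr t.
Proof. exact: big_cat. Qed.

Lemma wsqr_mul (s t : seq (K * {poly K})) : nneg_weights s -> nneg_weights t ->
  exists2 r, nneg_weights r & wsqr r = wsqr s * wsqr t.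
Proof.
move=> /allP s0 /allP t0.
exists [seq (u.1 * v.1, u.2 * v.2) | u <- s, v <- t].
  apply/allP => _ /allpairsP[[u v] [us vt ->]] /=.
  by apply: mulr_ge0; [apply: s0|apply: t0].
rewrite /wsqr big_allpairs_dep mulr_suml; apply: eq_bigr => u _.
rewrite mulr_sumr; apply: eq_bigr => v _ /=.
by rewrite exprMn -scalerAl -scalerAr scalerA.
Qed.

(** If [g] were a product of two smaller polynomials, one of them would change sign between [a] and
    [b], and its root there would be a root of [g]. *)
Lemma irreducible_sign_change (g : {poly K}) (a b : K) :
  g.[a] * g.[b] < 0 -> (forall c, a <= c <= b -> ~~ root g c) ->
  (forall h : {poly K}, (size h < size g)%N ->
    h.[a] * h.[b] < 0 -> exists2 c, a <= c <= b & root h c) ->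
  irreducible_poly g.
Proof.
move=> sgn_g noroot_g smaller; split.
  rewrite ltnNge; apply/negP => /size1_polyC gE; move: sgn_g.
  by rewrite gE !hornerC -expr2 ltNge sqr_ge0.
move=> q q1 qg; have g0 : g != 0.
  by apply: contraTneq sgn_g => ->; rewrite !horner0 mulr0 ltxx.
rewrite -dvdp_size_eqp // eqn_leq dvdp_leq //= leqNgt; apply/negP => lt_qg.
have eg := divpK qg; set r := g %/ q in eg.
have r0 : r != 0 by apply: contraNneq g0 => r0; rewrite -eg r0 mul0r.
have q0 : q != 0 by apply: contraNneq g0 => q0; rewrite -eg q0 mulr0.
have lt_rg : (size r < size g)%N.
  have := size_mul r0 q0; rewrite eg => ->.
  by move: q1 q0; rewrite -size_poly_eq0; move: (size q) (size r) => x y; lia.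
have nr (h : {poly K}) c : h %| g -> a <= c <= b -> ~~ root h c.
  by move=> hg /noroot_g; apply: contraNN; apply: root_dvdp.
move: sgn_g; rewrite -eg !hornerM mulrACA ltNge => /negP; apply.
have ge0 (h : {poly K}) : (size h < size g)%N -> h %| g -> 0 <= h.[a] * h.[b].
  move=> hs hg; rewrite leNgt; apply/negP => /(smaller h hs)[c cab rc].
  by have := nr h c hg cab; rewrite rc.
by rewrite mulr_ge0 // ge0 // -eg ?dvdp_mulr ?dvdp_mull.
Qed.

End WeightedSquares.

(** * Artin-Schreier theory: a maximal cone orders a subfield *)

Section MaximalCone.
Local Open Scope classical_set_scope.

(** In an algebraically closed [Omega], where [-1] is a square, only a subfield can be ordered.
    Hence only squares of differences of members are required to lie in [P]; for a maximal cone
    these differences form the ordered subfield. *)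
Record precone (Omega : fieldType) (P : set Omega) : Prop := Precone {
  precone1 : P 1;
  preconeD : forall x y, P x -> P y -> P (x + y);
  preconeM : forall x y, P x -> P y -> P (x * y);
  precone_sqrB : forall x y, P x -> P y -> P ((x - y) ^+ 2);
  precone_anti : forall x, P x -> P (- x) -> x = 0 }.

Record maxcone (Omega : fieldType) := MaxCone {
  cone : set Omega;
  maxcone_pre : precone cone;
  maxcone_max : forall Q, precone Q -> cone `<=` Q -> Q `<=` cone }.

Lemma precone_maxcone (Omega : fieldType) (P : set Omega) :
  precone P -> exists M : maxcone Omega, P `<=` cone M.
Proof.
(* Taking the union with [P] makes the bound of the empty chain a precone as well. *)
move=> preP; pose good := [set A | precone (P `|` A)].
have [F Fgood Ftot|A [goodA maxA]] := @Zorn_bigcup Omega good.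
  pose V := P `|` \bigcup_(X in F) X.
  (* Each axiom concerns at most two members of the union, and these lie in a common precone. *)
  have pair x y : V x -> V y ->
      exists2 Q, precone Q & [/\ Q `<=` V, Q x & Q y].
    have sub X : F X -> P `|` X `<=` V.
      by move=> FX z [Pz|Xz]; [left|right; exists X].
    move=> [Px|[X FX Xx]] [Py|[Y FY Yy]].
    - by exists P => //; split=> // z; left.
    - exists (P `|` Y); first exact: Fgood.
      by split; [exact: sub|left|right].
    - exists (P `|` X); first exact: Fgood.
      by split; [exact: sub|right|left].
    - have [XY|YX] := Ftot _ _ FX FY.
        exists (P `|` Y); first exact: Fgood.
        by split; [exact: sub|right; apply: XY|right].
      exists (P `|` X); first exact: Fgood.
      by split; [exact: sub|right|right; apply: YX].
  split.
  - by left; apply: (precone1 preP).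
  - by move=> x y Vx /(pair _ _ Vx)[Q preQ [QV Qx Qy]]; apply: QV; apply: (preconeD preQ).
  - by move=> x y Vx /(pair _ _ Vx)[Q preQ [QV Qx Qy]]; apply: QV; apply: (preconeM preQ).
  - by move=> x y Vx /(pair _ _ Vx)[Q preQ [QV Qx Qy]]; apply: QV;
    apply: (precone_sqrB preQ).
  - by move=> x Vx /(pair _ _ Vx)[Q preQ [QV Qx Qy]]; apply: (precone_anti preQ).
have Amax Q : precone Q -> P `|` A `<=` Q -> Q `<=` P `|` A.
  move=> preQ AQ x Qx; have [//|nAx] := pselect ((P `|` A) x).
  have AB : A `<` Q.
    rewrite classical_sets.properEneq; split; last by move=> z Az; apply: AQ; right.
    by apply/eqP => AQe; apply: nAx; right; rewrite AQe.
  case: (maxA _ AB); rewrite /good /=; suff -> : P `|` Q = Q by [].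
  by apply: classical_sets.setUidr => z Pz; apply: AQ; left.
by exists (MaxCone goodA Amax) => z Pz; left.
Qed.

Section ConeField.
Variables (Omega : fieldType) (M : maxcone Omega).
Local Notation P := (cone M).

Let preP := maxcone_pre M.

Lemma cone0 : P 0.
Proof.
have -> : 0 = (1 - 1) ^+ 2 :> Omega by rewrite subrr expr0n.
by apply: (precone_sqrB preP); apply: (precone1 preP).
Qed.

Lemma coneX x n : P x -> P (x ^+ n).
Proof.
move=> Px; elim: n => [|n IHn]; first exact: (precone1 preP).
by rewrite exprS; apply: (preconeM preP).
Qed.

(** The elements that enter the cone after multiplication by some power of [x] form a precone, which
    maximality identifies with [P]. *)
Lemma coneV x : P x -> P x^-1.
Proof.
move=> Px; have [->|x0] := eqVneq x 0; first by rewrite invr0; exact: cone0.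
pose Q := [set y | exists n, P (y * x ^+ n)].
have preQ : precone Q.
  split.
  - by exists 0%N; rewrite mulr1; apply: (precone1 preP).
  - move=> y z [n Py] [m Pz]; exists (n + m)%N.
    rewrite mulrDl exprD {2}(mulrC (x ^+ n)) !mulrA.
    by apply: (preconeD preP); apply: (preconeM preP) => //; apply: coneX.
  - move=> y z [n Py] [m Pz]; exists (n + m)%N.
    by rewrite exprD mulrACA; apply: (preconeM preP).
  - move=> y z [n Py] [m Pz]; exists ((n + m) * 2)%N.
    rewrite exprM -exprMn mulrBl exprD {2}(mulrC (x ^+ n)) !mulrA.
    by apply: (precone_sqrB preP) => //; apply: (preconeM preP) => //; apply: coneX.
  - move=> y [n Py] [m Pz]; have : y * x ^+ (n + m) = 0.
      apply: (precone_anti preP).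
        by rewrite exprD mulrA; apply: (preconeM preP) => //; apply: coneX.
      by rewrite addnC exprD -mulNr mulrA; apply: (preconeM preP) => //; apply: coneX.
    by move/eqP; rewrite mulf_eq0 expf_eq0 (negPf x0) andbF orbF => /eqP.
apply: (maxcone_max preQ); first by move=> y Py; exists 0%N; rewrite mulr1.
by exists 1%N; rewrite mulVf //; apply: (precone1 preP).
Qed.

Definition cone_field : {pred Omega} :=
  fun x => `[< exists y z, [/\ P y, P z & x = y - z] >].

Lemma cone_fieldP x :
  reflect (exists y z, [/\ P y, P z & x = y - z]) (x \in cone_field).
Proof. exact: asboolP. Qed.

Lemma cone_field_cone x : P x -> x \in cone_field.
Proof.
by move=> Px; apply/cone_fieldP; exists x, 0; split; rewrite ?subr0 //; exact: cone0.
Qed.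

Lemma cone_field_sqr x : x \in cone_field -> P (x ^+ 2).
Proof. by move=> /cone_fieldP[y [z [Py Pz ->]]]; apply: (precone_sqrB preP). Qed.

Lemma cone_fieldB x y :
  x \in cone_field -> y \in cone_field -> x - y \in cone_field.
Proof.
move=> /cone_fieldP[a [b [Pa Pb ->]]] /cone_fieldP[c [d [Pc Pd ->]]].
apply/cone_fieldP; exists (a + d), (b + c); split; do ?exact: (preconeD preP).
by ring.
Qed.

Lemma cone_fieldM x y :
  x \in cone_field -> y \in cone_field -> x * y \in cone_field.
Proof.
move=> /cone_fieldP[a [b [Pa Pb ->]]] /cone_fieldP[c [d [Pc Pd ->]]].
apply/cone_fieldP; exists (a * c + b * d), (a * d + b * c).
by split; [| |ring]; apply: (preconeD preP) => //; apply: (preconeM preP).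
Qed.

Lemma cone_fieldN x : x \in cone_field -> - x \in cone_field.
Proof.
by rewrite -sub0r; apply: cone_fieldB; apply: cone_field_cone; exact: cone0.
Qed.

(** If [x] is not in [P], then [- x] can be adjoined: a violation of antisymmetry in [P - x P] would
    express [x] as a quotient of two members of [P]. *)
Lemma cone_total x : x \in cone_field -> P x \/ P (- x).
Proof.
move=> Kx; have [Px|nPx] := pselect (P x); [by left|right].
pose Q := [set w | exists y z, [/\ P y, P z & w = y - x * z]].
have PK := cone_field_cone.
have preQ : precone Q.
  split.
  - exists 1, 0; split; [exact: (precone1 preP)|exact: cone0|].
    by rewrite mulr0 subr0.
  - move=> _ _ [y [z [Py Pz ->]]] [y' [z' [Py' Pz' ->]]].
    exists (y + y'), (z + z'); split; do ?exact: (preconeD preP).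
    by ring.
  - move=> _ _ [y [z [Py Pz ->]]] [y' [z' [Py' Pz' ->]]].
    exists (y * y' + x ^+ 2 * (z * z')), (y * z' + z * y'); split; last by ring.
      apply: (preconeD preP) => //;
        apply: (preconeM preP) => //; last exact: (preconeM preP).
      exact: cone_field_sqr.
    by apply: (preconeD preP) => //; apply: (preconeM preP).
  - move=> w w' [y [z [Py Pz ->]]] [y' [z' [Py' Pz' ->]]].
    exists ((y - x * z - (y' - x * z')) ^+ 2), 0; split; [|exact: cone0|by ring].
    apply: cone_field_sqr.
    by do ![exact: Kx | exact: PK | apply: cone_fieldB | apply: cone_fieldM].
  - move=> w [y [z [Py Pz ew]]] [y' [z' [Py' Pz' ew']]].
    have e : y + y' = x * (z + z').
      have e0 : (y - x * z) + (y' - x * z') = 0 by rewrite -ew -ew' subrr.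
      by rewrite -[RHS]add0r -e0; ring.
    have null (u v : Omega) : P u -> P v -> u + v = 0 -> u = 0.
      move=> Pu Pv /eqP; rewrite addr_eq0 => /eqP uv.
      by apply: (precone_anti preP); rewrite // uv opprK.
    have [zz0|zz0] := eqVneq (z + z') 0.
      rewrite zz0 mulr0 in e.
      by rewrite ew (null y y') // (null z z') // mulr0 subr0.
    case: nPx; rewrite -(mulfK zz0 x) -e.
    by apply: (preconeM preP) => //;
      [exact: (preconeD preP)|apply: coneV; apply: (preconeD preP)].
apply: (maxcone_max preQ).
  by move=> y Py; exists y, 0; split; rewrite ?mulr0 ?subr0 //; exact: cone0.
by exists 0, 1; split; [exact: cone0|exact: (precone1 preP)|rewrite mulr1 sub0r].
Qed.

Lemma cone_field_divring : divring_closed cone_field.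
Proof.
split; [|exact: cone_fieldB|]; first by apply: cone_field_cone; apply: (precone1 preP).
move=> x y Kx Ky; apply: cone_fieldM => //.
have [Py|Py] := cone_total Ky; first by apply/cone_field_cone/coneV.
by rewrite -[y]opprK invrN; apply/cone_fieldN/cone_field_cone/coneV.
Qed.

HB.instance Definition _ := GRing.isDivringClosed.Build Omega cone_field cone_field_divring.

Definition cone_elt : Type := {x : Omega | x \in cone_field}.
HB.instance Definition _ := SubChoice.on cone_elt.
HB.instance Definition _ := [SubChoice_isSubIntegralDomain of cone_elt by <:].
HB.instance Definition _ := [SubIntegralDomain_isSubField of cone_elt by <:].


Definition cone_le (x y : cone_elt) : bool := `[< P (val y - val x) >].
Definition cone_norm (x : cone_elt) : cone_elt := if cone_le 0 x then x else - x.

Let le0E x : cone_le 0 x = `[< P (val x) >].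
Proof. by rewrite /cone_le rmorph0 subr0. Qed.

Let lex0E x : cone_le x 0 = `[< P (- val x) >].
Proof. by rewrite /cone_le rmorph0 sub0r. Qed.

Let le0_add x y : cone_le 0 x -> cone_le 0 y -> cone_le 0 (x + y).
Proof.
rewrite !le0E rmorphD => /asboolP Px /asboolP Py.
by apply/asboolP; apply: (preconeD preP).
Qed.

Let le0_mul x y : cone_le 0 x -> cone_le 0 y -> cone_le 0 (x * y).
Proof.
rewrite !le0E rmorphM => /asboolP Px /asboolP Py.
by apply/asboolP; apply: (preconeM preP).
Qed.

Let le0_anti x : cone_le 0 x -> cone_le x 0 -> x = 0.
Proof.
rewrite le0E lex0E => /asboolP Px /asboolP Nx; apply: val_inj.
by rewrite rmorph0; apply: (precone_anti preP).
Qed.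

Let sub_ge0 x y : cone_le 0 (y - x) = cone_le x y.
Proof. by rewrite le0E rmorphB. Qed.

Let le0_total x : cone_le 0 x || cone_le x 0.
Proof.
rewrite le0E lex0E; apply/orP.
by have [Px|Px] := cone_total (valP x); [left|right]; apply/asboolP.
Qed.

Let normN x : cone_norm (- x) = cone_norm x.
Proof.
rewrite /cone_norm opprK; have NE : cone_le 0 (- x) = cone_le x 0.
  by rewrite le0E lex0E rmorphN.
rewrite NE; have [x0|x0] := boolP (cone_le 0 x); last first.
  by have := le0_total x; rewrite (negPf x0) /= => ->.
by case: ifP => // Nx; rewrite (le0_anti x0 Nx) oppr0.
Qed.

Let ge0_norm x : cone_le 0 x -> cone_norm x = x.
Proof. by rewrite /cone_norm => ->. Qed.

HB.instance Definition _ := Num.IntegralDomain_isLeReal.Build cone_elt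
  le0_add le0_mul le0_anti sub_ge0 le0_total normN ge0_norm (fun _ _ => erefl).

Lemma cone_elt_ge0 (x : cone_elt) : (0 <= x) = `[< P (val x) >].
Proof. exact: le0E. Qed.

Definition cone_val (x : cone_elt) : Omega := val x.

Fact cone_val_zmod : zmod_morphism cone_val.
Proof. exact: rmorphB. Qed.

Fact cone_val_monoid : monoid_morphism cone_val.
Proof. by []. Qed.

HB.instance Definition _ :=
  GRing.isZmodMorphism.Build cone_elt Omega cone_val cone_val_zmod.
HB.instance Definition _ :=
  GRing.isMonoidMorphism.Build cone_elt Omega cone_val cone_val_monoid.

Arguments cone_val : simpl never.

(** * The intermediate value property in the ordered subfield *)

Section Closed.
Hypothesis closedO : GRing.closed_field_axiom Omega.

Local Notation K := cone_elt.
Local Notation valp := (map_poly cone_val).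

Lemma poly_root_ext (g : {poly K}) : (1 < size g)%N ->
  exists x : Omega, root (valp g) x.
Proof.
move=> sg; have [n sgE] : exists n, size g = n.+2.
  by case: (size g) sg => [|[|n]] // _; exists n.
(* The closed field axiom concerns monic equations, hence the division by the leading
   coefficient. *)
have [x hx] := closedO (fun i => - cone_val (g`_i / lead_coef g)) (ltn0Sn n).
exists x; rewrite rootE; apply/eqP.
have lg : lead_coef g != 0 by rewrite lead_coef_eq0 -size_poly_gt0 sgE.
rewrite horner_coef size_map_poly sgE big_ord_recr /= hx mulr_sumr -big_split.
apply: big1 => i _ /=; rewrite !coef_map /= -[g`_n.+1]/(g`_n.+2.-1) -sgE.
by rewrite mulrA mulrN -!rmorphM /= mulrCA divff // mulr1 mulNr subrr.
Qed.

(** A counterexample of minimal size is irreducible. For a root [x] of it in [Omega], the weighted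
    sums of squares of elements of [K[x]] form a precone containing [P]. Maximality forces [x] into
    [K], so [g] is linear with its root outside the interval, and cannot change sign. *)
Lemma cone_poly_ivt (g : {poly K}) (a b : K) :
  a <= b -> g.[a] * g.[b] < 0 -> exists2 c, a <= c <= b & root g c.
Proof.
have [n] := ubnP (size g); elim: n g a b => // n IHn g a b.
rewrite ltnS => le_gn le_ab sgn_g; apply: contrapT => nex.
have noroot_g c : a <= c <= b -> ~~ root g c.
  by move=> cab; apply/negP => rc; apply: nex; exists c.
have smaller (h : {poly K}) : (size h < size g)%N ->
    h.[a] * h.[b] < 0 -> exists2 c, a <= c <= b & root h c.
  by move=> hs; apply: IHn => //; apply: leq_trans le_gn.
have irr_g := irreducible_sign_change sgn_g noroot_g smaller.
have [g_gt1 _] := irr_g.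
have [x gx] := poly_root_ext g_gt1.
have ev0 (h : {poly K}) : (valp h).[x] = 0 -> g %| h.
  move=> hx; apply: contraT => ngh.
  have := irreducible_poly_coprime h irr_g; rewrite ngh -(coprimep_map cone_val).
  by move=> /coprimep_root/(_ gx); rewrite hx eqxx.
pose Q := [set y | exists2 s, nneg_weights s & y = (valp (wsqr s)).[x]].
have Q1 (y : K) (h : {poly K}) : 0 <= y -> Q (cone_val y * (valp h).[x] ^+ 2).
  move=> y0; exists [:: (y, h)]; first by rewrite /nneg_weights /= y0.
  by rewrite /wsqr big_seq1 map_polyZ hornerZ rmorphXn horner_exp.
have preQ : precone Q.
  split.
  - by have := Q1 1 1 ler01; rewrite !rmorph1 hornerC expr1n mulr1.
  - move=> _ _ [s s0 ->] [t t0 ->]; exists (s ++ t).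
      by rewrite /nneg_weights all_cat; apply/andP.
    by rewrite wsqr_cat rmorphD hornerD.
  - move=> _ _ [s s0 ->] [t t0 ->]; have [r r0 er] := wsqr_mul s0 t0.
    by exists r; rewrite // er rmorphM hornerM.
  - move=> _ _ [s s0 ->] [t t0 ->].
    have := Q1 1 (wsqr s - wsqr t) ler01.
    by rewrite rmorph1 mul1r rmorphB hornerD hornerN.
  - move=> _ [s s0 ->] [t t0 est].
    (* Reduction modulo [g] keeps values at [x] and bounds degrees. The two reduced sums add up to a
       multiple of [g], so the descent [wsqr_dvdp] makes every term vanish. *)
    pose red (s : seq (K * {poly K})) := [seq (u.1, u.2 %% g) | u <- s].
    have redE r : (valp (wsqr (red r))).[x] = (valp (wsqr r)).[x].
      rewrite /wsqr big_map !rmorph_sum !horner_sum; apply: eq_bigr => u _ /=.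
      rewrite !map_polyZ !hornerZ !rmorphXn /= !horner_exp; congr (_ * _ ^+ 2).
      rewrite [in RHS](divp_eq u.2 g) rmorphD rmorphM hornerD hornerM.
      by rewrite (rootP gx) mulr0 add0r.
    have g0 : (0 < size g)%N by apply: ltnW.
    have red0 : {in red (s ++ t), forall u, u.1 = 0 \/ u.2 = 0}.
      apply: (wsqr_dvdp le_ab sgn_g noroot_g smaller (N := (size g).-1)).
      - by rewrite prednK.
      - by apply/allP => _ /mapP[u + ->]; rewrite mem_cat => /orP[/(allP s0)|/(allP t0)].
      - apply/allP => _ /mapP[u _ ->] /=.
        by rewrite -ltnS prednK // ltn_modp -size_poly_gt0.
      by apply: ev0; rewrite redE wsqr_cat rmorphD hornerD -est subrr.
    rewrite -redE; suff -> : wsqr (red s) = 0 by rewrite rmorph0 horner0.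
    rewrite /wsqr big_seq big1 // => u us.
    have ust : u \in red (s ++ t) by rewrite /red map_cat mem_cat us.
    by have [->|->] := red0 u ust; rewrite ?scale0r ?expr0n ?scaler0.
have PQ : P `<=` Q.
  move=> y Py; have Ky := cone_field_cone Py.
  have := @Q1 (Sub y Ky) 1; rewrite cone_elt_ge0 SubK rmorph1 hornerC expr1n mulr1.
  by apply; apply/asboolP.
have QP := maxcone_max preQ PQ.
have Kx : x \in cone_field.
  (* [x = ((x + 1) / 2) ^+ 2 - ((x - 1) / 2) ^+ 2], a difference of two members of [Q]. *)
  apply/cone_fieldP; pose q (c : K) := (2^-1)%:P * ('X + c%:P).
  exists ((valp (q 1)).[x] ^+ 2), ((valp (q (- 1))).[x] ^+ 2).
  have Pq c : P ((valp (q c)).[x] ^+ 2).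
    by apply: QP; have := Q1 1 (q c) ler01; rewrite rmorph1 mul1r.
  split; [exact: Pq|exact: Pq|].
  have qE c : (valp (q c)).[x] = cone_val 2^-1 * (x + cone_val c).
    by rewrite rmorphM rmorphD /= !map_polyC map_polyX !hornerE.
  have i2 : cone_val 2^-1 * 2 = 1.
    by rewrite -(rmorph_nat cone_val 2) -rmorphM mulVf ?rmorph1 // pnatr_eq0.
  rewrite !qE rmorphN rmorph1; transitivity ((cone_val 2^-1 * 2) ^+ 2 * x).
    by rewrite i2 expr1n mul1r.
  by ring.
pose k : K := Sub x Kx; have kx : cone_val k = x by apply: SubK.
have rk : root g k by move: gx; rewrite -[x in root _ x]kx fmorph_root.
have gk : 'X - k%:P %= g.
  have [_ h] := irr_g; apply: h; last by rewrite dvdp_XsubCl.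
  by rewrite size_XsubC.
have /eqpf_eq[c c0 eg] : g %= 'X - k%:P by rewrite eqp_sym.
have kab : ~~ (a <= k <= b) by apply/negP => /noroot_g; rewrite rk.
move: sgn_g; rewrite eg !hornerZ !hornerXsubC mulrACA -expr2 pmulr_rlt0; last first.
  by rewrite exprn_even_gt0.
move: kab; rewrite negb_and -!ltNge => kab; rewrite ltNge => /negP; apply.
case/orP: kab => kab.
  by rewrite mulr_ge0 // subr_ge0 ltW // (lt_le_trans kab).
by rewrite mulr_le0 // subr_le0 ltW // (le_lt_trans le_ab).
Qed.

Fact cone_real_closed : Num.real_closed_axiom K.
Proof.
move=> p a b le_ab /andP[pa pb]; have [ra|ra] := eqVneq p.[a] 0.
  by exists a; rewrite ?lexx // rootE ra.
have [rb|rb] := eqVneq p.[b] 0.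
  by exists b; rewrite ?lexx ?le_ab // rootE rb.
apply: cone_poly_ivt => //; rewrite nmulr_rlt0; first by rewrite lt_neqAle eq_sym rb.
by rewrite lt_neqAle ra.
Qed.

End Closed.

End ConeField.
End MaximalCone.

Lemma precone_real_closed (Omega : fieldType) (P : set Omega) :
  GRing.closed_field_axiom Omega -> precone P ->
  exists (K : rcfType) (f : {rmorphism K -> Omega}),
    forall x, P x -> exists2 y : K, 0 <= y & f y = x.
Proof.
move=> closedO /precone_maxcone[M PM].
pose rcM := Num.RealField_isClosed.Build (cone_elt M) (cone_real_closed closedO).
pose K : rcfType := HB.pack (cone_elt M) rcM.
exists K, (@cone_val Omega M) => x /PM Mx; exists (Sub x (cone_field_cone Mx) : cone_elt M).
  by rewrite cone_elt_ge0; apply/asboolP; rewrite SubK.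
exact: SubK.
Qed.

(** * Hilbert's 17th problem *)

(** Any choice of preimages is a morphism, since the field morphism [f] is injective. *)
Lemma lift_rmorphism (A : comNzRingType) (K Omega : fieldType)
    (f : {rmorphism K -> Omega}) (g : {rmorphism A -> Omega}) :
  (forall x, exists y, f y = g x) ->
  exists h : {rmorphism A -> K}, forall x, f (h x) = g x.
Proof.
move=> /boolp.choice[h hE].
have hB : zmod_morphism h.
  by move=> x y; apply: (fmorph_inj f); rewrite rmorphB !hE rmorphB.
have hM : monoid_morphism h.
  split; first by apply: (fmorph_inj f); rewrite hE !rmorph1.
  by move=> x y; apply: (fmorph_inj f); rewrite rmorphM !hE rmorphM.
pose hA := GRing.isZmodMorphism.Build _ _ h hB.
pose hAM := GRing.isMonoidMorphism.Build _ _ h hM.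
by exists (HB.pack h hA hAM : {rmorphism A -> K}).
Qed.

Section Artin.
Variables (R : realType) (n : nat).
Implicit Types p q f s t : {mpoly R[n]}.

Lemma sos_poly_sqr p : sos_poly (p ^+ 2).
Proof. by exists [:: p]; rewrite big_seq1. Qed.

Lemma sos_poly0 : sos_poly (0 : {mpoly R[n]}).
Proof. by exists [::]; rewrite big_nil. Qed.

Lemma sos_poly1 : sos_poly (1 : {mpoly R[n]}).
Proof. by rewrite -(expr1n _ 2); apply: sos_poly_sqr. Qed.

Lemma sos_polyD p q : sos_poly p -> sos_poly q -> sos_poly (p + q).
Proof. by move=> [u ->] [v ->]; exists (u ++ v); rewrite big_cat. Qed.

Lemma sos_polyM p q : sos_poly p -> sos_poly q -> sos_poly (p * q).
Proof.
move=> [u ->] [v ->]; exists [seq x * y | x <- u, y <- v].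
rewrite big_allpairs_dep mulr_suml; apply: eq_bigr => x _.
by rewrite mulr_sumr; apply: eq_bigr => y _; rewrite exprMn.
Qed.

Lemma sos_poly_ge0 p a : sos_poly p -> 0 <= p.@[a].
Proof.
move=> [u ->]; rewrite rmorph_sum; apply: sumr_ge0 => x _.
by rewrite rmorphXn sqr_ge0.
Qed.

Lemma mpoly_eq0P p : (forall a, p.@[a] = 0) -> p = 0.
Proof.
move=> p0; apply/eqP; apply: contraT => /mpoly_neq0_point[a].
by rewrite p0 eqxx.
Qed.

Lemma sos_polyD_eq0 p q : sos_poly p -> sos_poly q -> p + q = 0 -> p = 0.
Proof.
move=> sp sq pq0; apply: mpoly_eq0P => a; apply/eqP.
rewrite eq_le sos_poly_ge0 // andbT.
have := sos_poly_ge0 a sq; suff -> : q = - p by rewrite mevalN oppr_ge0.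
by apply/eqP; rewrite -addr_eq0 addrC pq0.
Qed.

Theorem artin_sos f : (forall a, 0 <= f.@[a]) ->
  exists sigma, [/\ sos_poly sigma, sigma != 0 & sos_poly (sigma * f)].
Proof.
move=> f_ge0; apply: contrapT => nex.
have sos0 s : sos_poly s -> sos_poly (s * f) -> s = 0.
  move=> ss ssf; apply/eqP/negPn/negP => s0; apply: nex; by exists s.
have f0 : f != 0.
  apply: contra_notN nex => /eqP ->; exists 1; rewrite oner_neq0 mulr0.
  by split=> //; [exact: sos_poly1|exact: sos_poly0].
have [Omega [i [inj_i closedO]]] := mpoly_closed_extension R n.
pose P : set Omega :=
  [set x | exists s t, [/\ sos_poly s, sos_poly t & x = i (s - f * t)]]%classic.
have Psos s : sos_poly s -> P (i s).
  by exists s, 0; split=> //; [exact: sos_poly0|rewrite mulr0 subr0].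
have preP : precone P.
  split.
  - by rewrite -(rmorph1 i); apply/Psos/sos_poly1.
  - move=> _ _ [s [t [ss st ->]]] [s' [t' [ss' st' ->]]].
    exists (s + s'), (t + t'); split; do ?exact: sos_polyD.
    by rewrite -rmorphD; congr (i _); ring.
  - move=> _ _ [s [t [ss st ->]]] [s' [t' [ss' st' ->]]].
    exists (s * s' + f ^+ 2 * (t * t')), (s * t' + t * s'); split.
    + by do ![exact: sos_poly_sqr | apply: sos_polyD | apply: sos_polyM].
    + by do ![apply: sos_polyD | apply: sos_polyM].
    + by rewrite -rmorphM; congr (i _); ring.
  - move=> _ _ [s [t [ss st ->]]] [s' [t' [ss' st' ->]]].
    by rewrite -rmorphB -rmorphXn; apply/Psos/sos_poly_sqr.
  - move=> _ [s [t [ss st ->]]] [s' [t' [ss' st' /eqP]]].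
    rewrite -rmorphN (inj_eq inj_i) => /eqP e.
    (* Since [f] has no representation, this identity between sums of squares forces [t + t' = 0],
       then [s + s' = 0], so [s] and [t] vanish. *)
    have e1 : s + s' = (t + t') * f.
      have e2 : - (s - f * t) - (s' - f * t') = 0 by rewrite e subrr.
      by rewrite -[LHS]addr0 -e2; ring.
    have t0 : t + t' = 0.
      by apply: sos0; [exact: sos_polyD|rewrite -e1; exact: sos_polyD].
    rewrite t0 mul0r in e1.
    by rewrite (sos_polyD_eq0 ss ss' e1) (sos_polyD_eq0 st st' t0) mulr0 subrr rmorph0.
have [K [phi phiP]] := precone_real_closed closedO preP.
have [|j jE] := @lift_rmorphism _ _ _ phi i.
  (* [p = ((p + 1) / 2) ^ 2 - ((p - 1) / 2) ^ 2] *)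
  move=> p; pose h : {mpoly R[n]} := (2^-1)%:MP.
  have [y _ yE] := phiP _ (Psos _ (sos_poly_sqr (h * (p + 1)))).
  have [z _ zE] := phiP _ (Psos _ (sos_poly_sqr (h * (p - 1)))).
  exists (y - z); rewrite rmorphB yE zE -rmorphB; congr (i _).
  have h2 : h * 2 = 1.
    by rewrite -(rmorph_nat (@mpolyC n R) 2) -mpolyCM mulVf ?mpolyC1 // pnatr_eq0.
  by rewrite -[RHS]mul1r -[1](expr1n _ 2) -{3}h2; ring.
have inj_j : injective j.
  by move=> p q e; apply: inj_i; rewrite -!jE e.
(* [- f] lies in the cone, with [s = 0] and [t = 1], so [f] is negative in [K]; transfer then gives
   a real point where [f] is negative. *)
have [y y0 yE] : exists2 y : K, 0 <= y & phi y = i (- f).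
  by apply: phiP; exists 0, 1; split;
    [exact: sos_poly0|exact: sos_poly1|rewrite mulr1 sub0r].
have jf : 0 < j (- f).
  rewrite lt0r -{1}(rmorph0 j) (inj_eq inj_j) oppr_eq0 f0 /=.
  by have -> : j (- f) = y by apply: (fmorph_inj phi); rewrite jE.
have [|a /(_ (- f) (mem_head _ _))] := @mpoly_positive_point _ _ _ j [:: - f] inj_j.
  by move=> g; rewrite inE => /eqP ->.
by rewrite mevalN oppr_gt0 ltNge f_ge0.
Qed.

End Artin.

(** * Chordal decomposition *)

Lemma psd_cauchy_schwarz (R : realType) m (B : 'M[R]_m) (v w : 'cV[R]_m) :
  psd B ->
  (w^T *m B *m v) ord0 ord0 ^+ 2 <=
  (w^T *m B *m w) ord0 ord0 * (v^T *m B *m v) ord0 ord0.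
Proof.
move=> [B_sym B_ge0].
have sym : (v^T *m B *m w) ord0 ord0 = (w^T *m B *m v) ord0 ord0.
  have -> : v^T *m B *m w = (w^T *m B *m v)^T.
    by rewrite !trmx_mul trmxK B_sym mulmxA.
  by rewrite mxE.
set b := (w^T *m B *m w) _ _; set q := (v^T *m B *m v) _ _.
set c := (w^T *m B *m v) _ _ in sym *.
have form s t : 0 <= s ^+ 2 * q + 2 * (s * t * c) + t ^+ 2 * b.
  have := B_ge0 (s *: v + t *: w).
  have -> : (s *: v + t *: w)^T = s *: v^T + t *: w^T.
    by rewrite linearD !linearZ.
  have -> : (s *: v^T + t *: w^T) *m B *m (s *: v + t *: w) =
      s ^+ 2 *: (v^T *m B *m v) + (s * t) *: (v^T *m B *m w + w^T *m B *m v)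
      + t ^+ 2 *: (w^T *m B *m w).
    rewrite !mulmxDl !mulmxDr -!scalemxAl -!scalemxAr !scalerA scalerDr !addrA.
    by rewrite [t * s]mulrC -!expr2.
  have addE (X Y : 'M[R]_1) : (X + Y) ord0 ord0 = X ord0 ord0 + Y ord0 ord0.
    by rewrite mxE.
  have scaleE k (X : 'M[R]_1) : (k *: X) ord0 ord0 = k * X ord0 ord0.
    by rewrite mxE.
  by rewrite !(addE, scaleE) sym -/b -/q -/c; congr (_ <= _); ring.
have b_ge0 : 0 <= b by apply: B_ge0.
have [b0|b0] := eqVneq b 0.
  rewrite b0 mul0r; have [->|c0] := eqVneq c 0; first by rewrite expr0n.
  (* For [b = 0] the form at [s = 1] is affine in [t]; this [t] gives it the value [-1]. *)
  have := form 1 (- (q + 1) / (2 * c)).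
  have -> : 1 ^+ 2 * q + 2 * (1 * (- (q + 1) / (2 * c)) * c) +
      (- (q + 1) / (2 * c)) ^+ 2 * b = - 1 by rewrite b0; field.
  by rewrite oppr_ge0 leNgt ltr01.
(* The minimiser of the form in direction [w], with denominators cleared. *)
have := form b (- c).
have -> : b ^+ 2 * q + 2 * (b * - c * c) + (- c) ^+ 2 * b = b * (b * q - c ^+ 2).
  by ring.
by rewrite pmulr_rge0 ?subr_ge0 // lt0r b0.
Qed.

Section ChordalDecomposition.
Variables (R : realType) (n m : nat) (e : rel 'I_m).
Hypotheses (e_sym : ssrbool.symmetric e) (e_irr : irreflexive e).
Hypothesis e_chordal : chordal e.

Local Notation Rx := {mpoly R[n]}.
Implicit Types (M : 'M[Rx]_m) (w : 'rV[Rx]_m).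

Definition clique_supported w :=
  exists2 A : {set 'I_m}, clique e A & forall j, w ord0 j != 0 -> j \in A.

Lemma clique_supportedZ q w : clique_supported w -> clique_supported (q *: w).
Proof.
move=> [A cA wA]; exists A => // j; rewrite mxE => qw; apply: wA.
by apply: contraNneq qw => ->; rewrite mulr0.
Qed.

Lemma sos_scale_gram (s : Rx) (ws : seq 'rV[Rx]_m) :
  sos_poly s -> (forall w, w \in ws -> clique_supported w) ->
  exists2 vs : seq 'rV[Rx]_m, (forall v, v \in vs -> clique_supported v) &
    s *: (\sum_(w <- ws) w^T *m w) = \sum_(v <- vs) v^T *m v.
Proof.
move=> [qs ->] ws_supp; exists [seq q *: w | q <- qs, w <- ws].
  by move=> _ /allpairsP[[q w] [_ /ws_supp ? ->]]; apply: clique_supportedZ.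
rewrite big_allpairs_dep scaler_suml; apply: eq_bigr => q _.
rewrite scaler_sumr; apply: eq_bigr => w _ /=.
have -> : (q *: w)^T = q *: w^T by rewrite linearZ.
by rewrite -scalemxAl -scalemxAr scalerA.
Qed.

(** At a vector [v] the new form is the gap in the Cauchy-Schwarz inequality for [v] and the [i]-th
    basis vector. *)
Lemma psd_schur M i (x : 'I_n -> R) : psd (map_mx (meval x) M) ->
  psd (map_mx (meval x) (M i i *: M - (row i M)^T *m row i M)).
Proof.
move=> psdM; have [B_sym _] := psdM; set B := map_mx _ M in psdM B_sym.
have -> : map_mx (meval x) (M i i *: M - (row i M)^T *m row i M) =
    B i i *: B - (row i B)^T *m row i B.
  by apply/matrixP => j l; rewrite !mxE !big_ord1 !mxE rmorphB !rmorphM.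
split.
  by rewrite linearB linearZ /= trmx_mul trmxK B_sym.
move=> v; pose d : 'cV[R]_m := delta_mx i ord0.
have rE : row i B = d^T *m B by rewrite rowE trmx_delta.
rewrite mulmxBr mulmxBl -scalemxAr -scalemxAl mxE mxE [X in _ + X]mxE subr_ge0.
have := psd_cauchy_schwarz v d psdM.
have -> : (d^T *m B *m d) ord0 ord0 = B i i by rewrite -rE -colE !mxE.
have -> : v^T *m ((row i B)^T *m row i B) *m v = (d^T *m B *m v)^T *m (d^T *m B *m v).
  by rewrite -rE trmx_mul !mulmxA.
suff -> (X : 'M[R]_1) : (X^T *m X) ord0 ord0 = X ord0 ord0 ^+ 2 by [].
by rewrite mxE big_ord1 mxE.
Qed.

Lemma psd_row0 M i : (forall x, psd (map_mx (meval x) M)) -> M i i = 0 ->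
  forall j, M i j = 0.
Proof.
move=> psdM Mii j; apply: mpoly_eq0P => x.
have := psd_cauchy_schwarz (delta_mx j ord0) (delta_mx i ord0) (psdM x).
rewrite !trmx_delta -!rowE -!colE !mxE Mii meval0 mul0r.
by move=> le0; apply/eqP; rewrite -sqrf_eq0 eq_le le0 sqr_ge0.
Qed.

Lemma psd_diag_ge0 M i x : psd (map_mx (meval x) M) -> 0 <= (M i i).@[x].
Proof.
case=> _ /(_ (delta_mx i ord0)).
by rewrite trmx_delta -rowE -colE !mxE.
Qed.

(** Induction on the set [V] carrying the support of [M], while the graph [e] stays fixed: each
    elimination removes a simplicial vertex of [V] from the support. *)
Theorem chordal_gram_decomposition (V : {set 'I_m}) M :
  M^T = M -> (forall x, psd (map_mx (meval x) M)) ->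
  (forall i j, M i j != 0 -> [/\ i \in V, j \in V & (i == j) || e i j]) ->
  exists (sigma : Rx) (ws : seq 'rV[Rx]_m),
    [/\ sos_poly sigma, sigma != 0, forall w, w \in ws -> clique_supported w &
        sigma *: M = \sum_(w <- ws) w^T *m w].
Proof.
have [k] := ubnP #|V|; elim: k => // k IHk in V M *.
rewrite ltnS => leVk M_sym M_psd M_supp.
have [V0|V0] := eqVneq V set0.
  exists 1, [::]; split; rewrite ?oner_neq0 //; first exact: sos_poly1.
  rewrite big_nil scale1r; apply/matrixP => i j; rewrite mxE; apply/eqP.
  by apply: contraT => /M_supp[]; rewrite V0 inE.
have [i iV simp_i] := exists_simplicial e_sym e_irr e_chordal V0.
have MC j l : M j l = M l j by rewrite -[in LHS]M_sym mxE.
have ltV : (#|V :\ i| < k)%N by move: leVk; rewrite (cardsD1 i V) iV.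
(* With a zero pivot the whole row vanishes by Cauchy-Schwarz, so [i] is dropped without
   elimination. *)
have [Mii|Mii] := eqVneq (M i i) 0.
  have Mi0 := psd_row0 M_psd Mii.
  apply: (IHk (V :\ i) M) => // j l Mjl; have [jV lV ejl] := M_supp j l Mjl.
  rewrite !inE jV lV !andbT; split=> //; apply: contraNneq Mjl => ->.
    by rewrite Mi0.
  by rewrite MC Mi0.
have nbi j : M i j != 0 -> j != i -> j \in V /\ e i j.
  by move=> /M_supp[_ jV eij] ji; move: eij; rewrite eq_sym (negPf ji).
pose M' := M i i *: M - (row i M)^T *m row i M.
have M'E j l : M' j l = M i i * M j l - M i j * M i l.
  by rewrite !mxE big_ord1 !mxE.
have M'i l : M' i l = 0 by rewrite M'E subrr.
have M'_sym : M'^T = M'.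
  by rewrite /M' linearB linearZ /= trmx_mul trmxK M_sym.
have [||sigma [ws [ss s0 ws_supp eM']]] := IHk (V :\ i) M' ltV M'_sym.
- by move=> x; apply: psd_schur.
- move=> j l M'jl.
  have ji : j != i by apply: contraNneq M'jl => ->; rewrite M'i.
  have li : l != i.
    by apply: contraNneq M'jl => ->; rewrite -M'_sym mxE M'i.
  rewrite !inE ji li /=; have [Mjl|Mjl] := eqVneq (M j l) 0; last exact: M_supp.
  (* A fill-in at [(j, l)] needs [M i j] and [M i l] nonzero, so [j] and [l] are neighbours of the
     simplicial vertex [i]. *)
  move: M'jl; rewrite M'E Mjl mulr0 sub0r oppr_eq0 mulf_eq0 negb_or => /andP[Mij Mil].
  have [jV eij] := nbi j Mij ji; have [lV eil] := nbi l Mil li.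
  by split=> //; have [//|jl] := eqVneq j l; apply: simp_i.
have [tau [st t0 sta]] := artin_sos (fun x => psd_diag_ge0 i (M_psd x)).
have wi_supp w : w \in [:: row i M] -> clique_supported w.
  rewrite inE => /eqP ->; exists [set j | M i j != 0]; last first.
    by move=> j; rewrite mxE inE.
  apply/forall_inP => j; rewrite inE => Mij; apply/forall_inP => l.
  rewrite inE => Mil; apply/implyP => jl.
  have [ji|ji] := eqVneq j i.
    by rewrite ji; have [] := nbi l Mil; rewrite // -ji eq_sym.
  have [jV eij] := nbi j Mij ji.
  have [->|li] := eqVneq l i; first by rewrite e_sym.
  by have [lV eil] := nbi l Mil li; apply: simp_i.
have [us us_supp eus] := sos_scale_gram (sos_polyM st ss) wi_supp.
have [vs vs_supp evs] := sos_scale_gram st ws_supp.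
(* [M i i *: M] is [M'] plus the Gram matrix of row [i]. Scaling by [sigma] decomposes [M'], and
   [tau] turns the factor [M i i] into a sum of squares. *)
exists (tau * M i i * sigma), (us ++ vs); split.
- exact: sos_polyM.
- by rewrite !mulf_neq0.
- by move=> w; rewrite mem_cat => /orP[/us_supp|/vs_supp].
rewrite big_cat -eus -evs -eM' big_seq1 /= /M' scalerBr scalerBr !scalerA.
by rewrite [tau * M i i * sigma]mulrAC addrC subrK.
Qed.

End ChordalDecomposition.

(** * Assembling rank-one terms into clique blocks *)

Section CliqueGather.
Variables (R : realType) (n m : nat).
Local Notation Rx := {mpoly R[n]}.

Lemma sos_mxD p (A B : 'M[Rx]_p) : sos_mx A -> sos_mx B -> sos_mx (A + B).
Proof.
move=> [r [H ->]] [s [K ->]]; exists (r + s)%N, (col_mx H K).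
by rewrite tr_col_mx mul_row_col.
Qed.

Lemma sos_mx_gram p r (H : 'M[Rx]_(r, p)) : sos_mx (H^T *m H).
Proof. by exists r, H. Qed.

Lemma sos_mx0 p : sos_mx (0 : 'M[Rx]_p).
Proof. by exists 0%N, 0; rewrite mulmx0. Qed.

(** The product of the transposed clique matrix with itself is the diagonal projection onto the
    coordinates in [C]. *)
Lemma clique_mxK (C : {set 'I_m}) (w : 'rV[Rx]_m) :
  (forall j, w ord0 j != 0 -> j \in C) ->
  w *m (clique_mx Rx C)^T *m clique_mx Rx C = w.
Proof.
move=> wC; apply/rowP => j; rewrite mxE.
have wE i : (w *m (clique_mx Rx C)^T) ord0 i = w ord0 (enum_val i).
  rewrite mxE (bigD1 (enum_val i)) //= !mxE eqxx mulr1 big1 ?addr0 // => l li.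
  by rewrite !mxE eq_sym (negPf li) mulr0.
have [jC|jC] := boolP (j \in C).
  rewrite (bigD1 (enum_rank_in jC j)) //= wE mxE enum_rankK_in // eqxx mulr1.
  rewrite big1 ?addr0 // => l lj.
  have [el|/negPf ne] := eqVneq (enum_val l) j; last by rewrite wE mxE ne mulr0.
  by case/eqP: lj; apply: enum_val_inj; rewrite enum_rankK_in.
have -> : w ord0 j = 0 by apply/eqP; apply: contraNT jC => /wC.
apply: big1 => l _.
have [el|/negPf ne] := eqVneq (enum_val l) j; last by rewrite wE mxE ne mulr0.
by case/negP: jC; rewrite -el enum_valP.
Qed.

Lemma gather_cliques t (C : 'I_t -> {set 'I_m}) (ws : seq 'rV[Rx]_m) :
  (forall w, w \in ws -> exists k, forall j, w ord0 j != 0 -> j \in C k) ->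
  exists S : forall k : 'I_t, 'M[Rx]_#|C k|,
    (forall k, sos_mx (S k)) /\
    \sum_(w <- ws) w^T *m w =
    \sum_(k < t) (clique_mx Rx (C k))^T *m S k *m clique_mx Rx (C k).
Proof.
elim: ws => [_|w ws IHws wsC].
  exists (fun k => 0); split=> [k|]; first exact: sos_mx0.
  by rewrite big_nil big1 // => k _; rewrite mulmx0 mul0mx.
have [|S [S_sos eS]] := IHws.
  by move=> v vs; apply: wsC; rewrite inE vs orbT.
have [k0 wk0] := wsC w (mem_head _ _).
pose wE k := w *m (clique_mx Rx (C k))^T.
pose S' k := S k + (if k == k0 then (wE k)^T *m wE k else 0).
exists S'; split=> [k|].
  by apply: sos_mxD => //; case: ifP => _; [apply: sos_mx_gram|apply: sos_mx0].
rewrite big_cons addrC eS /S'.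
under [RHS]eq_bigr do rewrite mulmxDr mulmxDl.
rewrite big_split /=; congr (_ + _); rewrite (bigD1 k0) //= eqxx big1 ?addr0.
  rewrite -[w in LHS](clique_mxK wk0) -/(wE k0).
  by rewrite (trmx_mul (wE k0)) !mulmxA.
by move=> k /negPf ->; rewrite mulmx0 mul0mx.
Qed.

End CliqueGather.

Theorem theorem2p2 (R : realType) (n m : nat) (P : 'M[{mpoly R[n]}]_m)
  (t : nat) (C : 'I_t -> {set 'I_m})
  (P_sym : P^T = P)
  (P_psd : forall x : 'I_n -> R, psd (map_mx (meval x) P))
  (P_chordal : chordal (sparsity_graph P))
  (C_inj : injective C)
  (C_max : forall A : {set 'I_m},
     maximal_clique (sparsity_graph P) A <-> exists k : 'I_t, C k = A) :
  exists (sigma : {mpoly R[n]}) (S : forall k : 'I_t, 'M[{mpoly R[n]}]_#|C k|),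
    [/\ sos_poly sigma, sigma != 0, forall k : 'I_t, sos_mx (S k) &
        sigma *: P =
        \sum_(k < t) (clique_mx {mpoly R[n]} (C k))^T *m S k
                     *m clique_mx {mpoly R[n]} (C k)].
Proof.
have [|||sigma [ws [ss s0 ws_supp eP]]] :=
    @chordal_gram_decomposition R n m (sparsity_graph P) _ _ P_chordal
      [set: 'I_m] P P_sym P_psd.
- by move=> i j; rewrite /sparsity_graph eq_sym -{1}P_sym mxE.
- by move=> i; rewrite /sparsity_graph eqxx.
- by move=> i j Pij; rewrite !inE /sparsity_graph Pij andbT orbN.
have [|S [S_sos eS]] := @gather_cliques R n m t C ws.
  (* The clique supporting [w] is enlarged to a maximal one, which is some [C k]. *)
  move=> w /ws_supp[A cA wA]; have [B maxB AB] := maxset_exists cA.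
  have [k Ck] := (C_max B).1 maxB; exists k => j /wA jA.
  by rewrite Ck (subsetP AB).
by exists sigma, S; rewrite eP.
Qed.
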